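(* Let $G$ be a graph on $\{1,\dots,n\}$, let $X=\mathcal F\cap\mathcal C(G)$ be a fixed hull and contact class, and let $\mathbf c\in X$ be a relative interior regular point. Let $i$ be a hull leaf, and let $j$ be its unique neighbour in $G$. Let $\mathbf t_{\mathrm{in}}(i)$ and $\mathbf t_{\mathrm{out}}(i)$ be the incoming and outgoing unit tangent vectors of the cyclic hull at $i$, and set $\mathbf g_i=\mathbf t_{\mathrm{in}}(i)-\mathbf t_{\mathrm{out}}(i)$. If $\mathbf c$ is class critical, then $\mathbf g_i$ is parallel to the contact normal $\mathbf u_{ij}$ (that is, $\mathbf g_i\in\operatorname{span}\{\mathbf u_{ij}\}$). Consequently, if $\mathbf g_i$ is not parallel to $\mathbf u_{ij}$, then $\mathbf c$ is not class critical and in particular cannot be a local minimiser of $\operatorname{Per}$ on $X$.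
   Context: $\mathcal D_n=\{\mathbf c\in(\mathbb R^2)^n:\|\mathbf c_i-\mathbf c_j\|\ge2\ \forall i\ne j\}$. For $\mathbf c\in\mathcal D_n$, $P(\mathbf c)=\operatorname{conv}\{\mathbf c_1,\dots,\mathbf c_n\}$ is the centre hull and $\operatorname{Per}(\mathbf c)$ is the length of the boundary of the convex hull of the union of the closed unit disks centred at $\mathbf c_1,\dots,\mathbf c_n$ (equal to $\operatorname{Per}(P(\mathbf c))+2\pi$). For a graph $G$ on $\{1,\dots,n\}$ with edge set $E(G)$: $\mathcal C(G)$ is the set of $\mathbf c\in\mathcal D_n$ with $\|\mathbf c_i-\mathbf c_j\|=2$ exactly for $\{i,j\}\in E(G)$ (and $>2$ for non-edges); $M(G)=\{\mathbf d\in(\mathbb R^2)^n:\|\mathbf d_i-\mathbf d_j\|=2\ \forall\{i,j\}\in E(G)\}$; $\mathbf d\in M(G)$ is regular for $G$ if the gradients at $\mathbf d$ of $g_{ij}(\mathbf d)=\|\mathbf d_j-\mathbf d_i\|^2-4$, $\{i,j\}\in E(G)$, are linearly independent. $\mathbf c$ is hull stable if all configurations of $\mathcal D_n$ in some neighbourhood of $\mathbf c$ have a centre hull with the same set of hull vertex indices and the same cyclic order as $P(\mathbf c)$. For hull stable $\mathbf c\in\mathcal C(G)$ regular for $G$, let $\mathcal F$ be the set of configurations whose centre hull has the same hull vertex set and cyclic order as $P(\mathbf c)$, and let $\mathcal B$ be the list of oriented hull edges in cyclic order. A fixed hull and contact class is a set $X=\mathcal F\cap\mathcal C(G)$ of this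 form. A point $\mathbf c\in X$ is a relative interior regular point if it is regular for $G$ and there is an open neighbourhood $U_0$ of $\mathbf c$ in $(\mathbb R^2)^n$ with $\|\mathbf d_i-\mathbf d_j\|>2$ for all $\mathbf d\in U_0\cap M(G)$ and all $\{i,j\}\notin E(G)$, and $U_0\cap\mathcal D_n\subset\mathcal F$ (so that $X\cap U_0=M(G)\cap U_0$). $\widetilde{\operatorname{Per}}(\mathbf d)=\sum_{(p,q)\in\mathcal B}\|\mathbf d_q-\mathbf d_p\|+2\pi$, which is smooth near $\mathbf c$ and equals $\operatorname{Per}$ on $\mathcal F$; $D\operatorname{Per}(\mathbf c)$ denotes $D\widetilde{\operatorname{Per}}(\mathbf c)$. For $\{i,j\}\in E(G)$, $\mathbf u_{ij}=(\mathbf c_j-\mathbf c_i)/\|\mathbf c_j-\mathbf c_i\|$. The rolling space is $\mathbf{Roll}(\mathbf c)=\{\delta\mathbf c\in(\mathbb R^2)^n:\langle\mathbf u_{ij},\delta\mathbf c_j-\delta\mathbf c_i\rangle=0\ \forall\{i,j\}\in E(G)\}$. $\mathbf c$ is class critical if $D\operatorname{Per}(\mathbf c)[\eta]=0$ for every $\eta\in\mathbf{Roll}(\mathbf c)$. A hull leaf is a hull vertex $i$ (an index whose centre is a vertex of $P(\mathbf c)$) that has degree one in $G$. If $(p,i),(i,q)\in\mathcal B$ are the hull edges entering and leaving $i$, then $\mathbf t_{\mathrm{in}}(i)=(\mathbf c_i-\mathbf c_p)/\|\mathbf c_i-\mathbf c_p\|$ and $\mathbf t_{\mathrm{out}}(i)=(\mathbf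 c_q-\mathbf c_i)/\|\mathbf c_q-\mathbf c_i\|$. *)

(* Defs.v *)
From HB Require Import structures.
From mathcomp Require Import all_boot all_order all_algebra.
From mathcomp Require Import all_classical all_reals all_analysis.

Set Implicit Arguments.
Unset Strict Implicit.
Unset Printing Implicit Defensive.

Import Order.TTheory GRing.Theory Num.Theory.
Import numFieldNormedType.Exports.

Local Open Scope classical_set_scope.
Local Open Scope ring_scope.

(* The library norm on matrices is the sup norm, which gives the right
   topology and differential but not the right distances: all lengths below
   use [enorm]. *)
Section plane.
Variable R : realType.
Implicit Types (u v x y : 'rV[R]_2) (A : set 'rV[R]_2).

Definition dot u v : R := \sum_(k < 2) u 0 k * v 0 k.

Definition enorm u : R := Num.sqrt (dot u u).

Definition normalize u : 'rV[R]_2 := (enorm u)^-1 *: u.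

Definition det2 u v : R := u 0 0 * v 0 1 - u 0 1 * v 0 0.

Definition disk x : set 'rV[R]_2 := [set y | enorm (y - x) <= 1].

Definition conv_hull A : set 'rV[R]_2 := smallest (@convex_set R 'rV[R]_2) A.

Definition extreme_point A x : Prop :=
  A x /\ forall y z (t : R), A y -> A z -> 0 < t < 1 ->
    x = (1 - t) *: y + t *: z -> y = z.

Definition boundary A : set 'rV[R]_2 := closure A `\` A°.

Local Open Scope ereal_scope.

(* The added 0 makes the diameter of the empty set 0 instead of -oo. *)
Definition diam A : \bar R :=
  ereal_sup ([set 0] `|` [set (enorm (x - y))%:E | x in A & y in A]).

Definition hausdorff1_pre (delta : R) A : \bar R :=
  ereal_inf [set \sum_(0 <= k <oo) diam (U k) |
    U in [set U : nat -> set 'rV[R]_2 |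
            (forall k, diam (U k) <= delta%:E) /\ A `<=` \bigcup_k U k]].

(* One-dimensional Hausdorff measure, i.e. the length of a rectifiable simple
   curve. *)
Definition hausdorff1 A : \bar R :=
  ereal_sup [set hausdorff1_pre delta A | delta in [set d : R | (0 < d)%R]].

End plane.

Section configurations.
Variables (R : realType) (n : nat).

(* The centre of index i is the i-th row. *)
Definition config := 'M[R]_(n, 2).

Implicit Types (c d eta : config) (i j p q : 'I_n) (e : rel 'I_n).

Definition dist c i j : R := enorm (row j c - row i c).

Definition udir c i j : 'rV[R]_2 := normalize (row j c - row i c).

Definition packings : set config :=
  [set c | forall i j, i != j -> 2 <= dist c i j].

Definition centre_hull c : set 'rV[R]_2 :=
  conv_hull (range (fun i => row i c)).

Definition Per c : \bar R :=
  hausdorff1 (boundary (conv_hull (\bigcup_i disk (row i c)))).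

Definition hull_vertices c : {set 'I_n} :=
  [set i | `[< extreme_point (centre_hull c) (row i c) >]]%SET.

(* (p, q) is a hull edge, oriented counterclockwise: the centre hull lies to
   the left of the directed line from p to q. A hull which is a segment with
   ends p, q has the two oriented edges (p, q) and (q, p). *)
Definition hull_edge c p q : Prop :=
  [/\ p \in hull_vertices c, q \in hull_vertices c, p != q &
      forall x, centre_hull c x ->
        0 <= det2 (row q c - row p c) (x - row p c)].

Definition hull_edges c : {set 'I_n * 'I_n} :=
  [set pq | `[< hull_edge c pq.1 pq.2 >]]%SET.

(* The cyclic order of the hull vertices is given by its successor relation,
   which is the set of oriented hull edges. *)
Definition same_hull c d : Prop :=
  hull_vertices d = hull_vertices c /\ hull_edges d = hull_edges c.

Definition hull_stable c : Prop :=
  \forall d \near c, packings d -> same_hull c d.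

(* The set $\mathcal F$ determined by the configuration c0. *)
Definition hull_class c0 : set config :=
  [set d | packings d /\ same_hull c0 d].

Definition contact_class e : set config :=
  [set c | packings c /\ forall i j, i != j ->
     if e i j then dist c i j = 2 else 2 < dist c i j].

Definition contact_variety e : set config :=
  [set d | forall i j, e i j -> dist d i j = 2].

Definition contact_fun i j d : R := dist d i j ^+ 2 - 4.

Definition grad (f : config -> R) d : config :=
  \matrix_(k < n, l < 2) 'D_(delta_mx k l) f d.

(* Each undirected edge is listed once. *)
Definition edges e : seq ('I_n * 'I_n) :=
  enum [set ij : 'I_n * 'I_n | (ij.1 < ij.2)%N && e ij.1 ij.2]%SET.

Definition regular e d : Prop :=
  contact_variety e d /\
  free [seq grad (contact_fun ij.1 ij.2) d | ij <- edges e].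

Definition class_base e c0 : Prop :=
  [/\ contact_class e c0, hull_stable c0 & regular e c0].

(* The fixed hull and contact class $X$ of c0, where [class_base e c0]. *)
Definition fixed_class e c0 : set config := hull_class c0 `&` contact_class e.

Definition rel_interior_regular e c0 c : Prop :=
  regular e c /\
  exists U : set config, [/\ open U, U c,
    forall d, (U `&` contact_variety e) d ->
      forall i j, i != j -> ~~ e i j -> 2 < dist d i j &
    U `&` packings `<=` hull_class c0].

Definition Per_tilde c0 d : R :=
  \sum_(pq in hull_edges c0) dist d pq.1 pq.2 + 2 * pi.

Definition Roll e c : set config :=
  [set eta | forall i j, e i j ->
     dot (udir c i j) (row j eta - row i eta) = 0].

Definition class_critical e c0 c : Prop :=
  forall eta, Roll e c eta -> 'd (Per_tilde c0) c eta = 0.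

Definition hull_leaf e c i : Prop :=
  i \in hull_vertices c /\ #|[set k | e i k]%SET| = 1%N.

Definition local_minimiser (f : config -> \bar R) (X : set config) c : Prop :=
  X c /\ \forall d \near c, X d -> (f c <= f d)%E.

End configurations.

(* Main.v *)
(* Write P for the centre hull and K for the convex hull of the unit disks. The
   boundary of K is the disjoint union of the hull edges, each pushed out by its
   unit normal, and of one arc of directions for each hull vertex; translated to
   the origin these arcs cover the unit circle and overlap only in the finitely
   many edge normals. Hence Per is the sum of the lengths of the hull edges plus
   the (finite) Hausdorff measure of the unit circle, whose value is never
   needed: on a class Per and Per_tilde differ by a constant.
   As j is the only neighbour of the leaf i, the circle about c_j stays in the
   contact variety when only c_i moves on it, and near c it stays in X. Only the
   two hull edges at i change length, so the derivative of Per along this motion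
   is the scalar product of g_i with its velocity, which is normal to u_ij. *)

(* Class criticality speaks of [Per_tilde] only, so the first claim is linear algebra. The work lies
   in the second claim, where minimality is stated for [Per], a Hausdorff measure of a boundary.
   This outer measure is not additive on arbitrary disjoint sets; additivity on arcs and sides comes
   from Caratheodory measurability, each piece being a finite Boolean combination of sublevel sets
   of Lipschitz functions (half planes and disks). The decomposition of the boundary rests on the
   nearest point of the centre hull: each boundary point is y + u for exactly one y in the centre
   hull and one unit outer normal u at y, and the pieces are sorted according to y. *)
Require Import Defs.
From HB Require Import structures.
From mathcomp Require Import all_boot all_order all_algebra.
From mathcomp Require Import all_classical all_reals all_analysis.
From mathcomp Require Import ring lra.

Set Implicit Arguments.
Unset Strict Implicit.
Unset Printing Implicit Defensive.

Import Order.TTheory GRing.Theory Num.Theory.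
Import numFieldNormedType.Exports.
Local Open Scope classical_set_scope.
Local Open Scope ring_scope.

(** * Euclidean plane *)

Section plane_algebra.
Variable R : realType.
Implicit Types (u v w x y z : 'rV[R]_2) (a b : R).

(** The counterclockwise quarter turn, so that pairing with [perp u] is [det2 u]. *)
Definition perp u : 'rV[R]_2 := \row_k (if k == 0 then - u 0 1 else u 0 0).

Lemma dotE u v : dot u v = u 0 0 * v 0 0 + u 0 1 * v 0 1.
Proof.
rewrite /dot big_ord_recl big_ord1.
by rewrite (_ : lift ord0 ord0 = 1 :> 'I_2)//; apply/val_inj.
Qed.

Lemma rV2P u v : u 0 0 = v 0 0 -> u 0 1 = v 0 1 -> u = v.
Proof.
move=> h0 h1; apply/rowP => k.
case: k => -[|[|//]] hk.
  by rewrite (_ : Ordinal hk = 0)//; exact/val_inj.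
by rewrite (_ : Ordinal hk = 1)//; exact/val_inj.
Qed.

Lemma dotC u v : dot u v = dot v u.
Proof. by rewrite !dotE; ring. Qed.

Lemma dotDl u v w : dot (u + v) w = dot u w + dot v w.
Proof. by rewrite !dotE !mxE; ring. Qed.

Lemma dotBl u v w : dot (u - v) w = dot u w - dot v w.
Proof. by rewrite !dotE !mxE; ring. Qed.

Lemma dotDr u v w : dot w (u + v) = dot w u + dot w v.
Proof. by rewrite !dotE !mxE; ring. Qed.

Lemma dotBr u v w : dot w (u - v) = dot w u - dot w v.
Proof. by rewrite !dotE !mxE; ring. Qed.

Lemma dotZl a u v : dot (a *: u) v = a * dot u v.
Proof. by rewrite !dotE !mxE; ring. Qed.

Lemma dotZr a u v : dot u (a *: v) = a * dot u v.
Proof. by rewrite !dotE !mxE; ring. Qed.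

Lemma dotNr u v : dot u (- v) = - dot u v.
Proof. by rewrite !dotE !mxE; ring. Qed.

Lemma dot0r u : dot u 0 = 0.
Proof. by rewrite !dotE !mxE; ring. Qed.

Lemma dot_perp u v : dot (perp u) (perp v) = dot u v.
Proof. by rewrite !dotE !mxE/=; ring. Qed.

Lemma dot_perpl u v : dot (perp u) v = det2 u v.
Proof. by rewrite /det2 !dotE !mxE/=; ring. Qed.

Lemma dot_perpr u : dot u (perp u) = 0.
Proof. by rewrite !dotE !mxE/=; ring. Qed.

Lemma dot_ge0 u : 0 <= dot u u.
Proof. by rewrite dotE; nra. Qed.

Lemma dot_eq0 u : dot u u = 0 -> u = 0.
Proof. by rewrite dotE => h; apply: rV2P; rewrite mxE; nra. Qed.

Lemma enorm_ge0 u : 0 <= enorm u.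
Proof. exact: sqrtr_ge0. Qed.

Lemma sqr_enorm u : enorm u ^+ 2 = dot u u.
Proof. by rewrite sqr_sqrtr// dot_ge0. Qed.

Lemma enorm_eqP u a : 0 <= a -> (enorm u = a <-> dot u u = a ^+ 2).
Proof.
move=> a0; split=> [<-|h]; first by rewrite sqr_enorm.
by rewrite /enorm h sqrtr_sqr ger0_norm.
Qed.

Lemma enorm_le u a : 0 <= a -> (enorm u <= a) = (dot u u <= a ^+ 2).
Proof. by move=> a0; rewrite -sqr_enorm ler_sqr ?nnegrE// enorm_ge0. Qed.

Lemma enorm0 : enorm (0 : 'rV[R]_2) = 0.
Proof. by rewrite /enorm dot0r sqrtr0. Qed.

Lemma enorm_eq0 u : enorm u = 0 -> u = 0.
Proof. by move=> h; apply: dot_eq0; rewrite -sqr_enorm h expr0n. Qed.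

Lemma enorm_gt0 u : (0 < enorm u) = (u != 0).
Proof.
rewrite lt_def enorm_ge0 andbT; congr negb; apply/eqP/eqP => [/enorm_eq0//|->].
exact: enorm0.
Qed.

Lemma enormZ a u : enorm (a *: u) = `|a| * enorm u.
Proof.
apply/enorm_eqP; first by rewrite mulr_ge0// enorm_ge0.
by rewrite exprMn sqr_enorm real_normK ?num_real// dotZl dotZr; ring.
Qed.

Lemma enormN u : enorm (- u) = enorm u.
Proof. by rewrite -scaleN1r enormZ normrN1 mul1r. Qed.

Lemma enormB u v : enorm (u - v) = enorm (v - u).
Proof. by rewrite -enormN opprB. Qed.

Lemma enorm_perp u : enorm (perp u) = enorm u.
Proof. by rewrite /enorm dot_perp. Qed.

Lemma dot_le_enorm u v : dot u v <= enorm u * enorm v.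
Proof.
have [h|h] := leP 0 (dot u v); last first.
  by rewrite (le_trans (ltW h))// mulr_ge0// enorm_ge0.
rewrite -ler_sqr ?nnegrE//; last by rewrite mulr_ge0// enorm_ge0.
(* Lagrange's identity: |u|^2 |v|^2 is the sum of the squares of [dot u v] and [det2 u v]. *)
by have := sqr_ge0 (det2 u v); rewrite exprMn !sqr_enorm !dotE /det2; nra.
Qed.

Lemma enorm_triangle u v : enorm (u + v) <= enorm u + enorm v.
Proof.
rewrite enorm_le; last by rewrite addr_ge0// enorm_ge0.
rewrite sqrrD !sqr_enorm dotDl !dotDr (dotC v u).
by have := dot_le_enorm u v; lra.
Qed.

Lemma enorm_tri x y z : enorm (x - z) <= enorm (x - y) + enorm (y - z).
Proof. by rewrite (le_trans _ (enorm_triangle _ _))// addrA subrK. Qed.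

Lemma enorm_normalize u : u != 0 -> enorm (normalize u) = 1.
Proof.
move=> u0; rewrite enormZ ger0_norm ?invr_ge0 ?enorm_ge0//.
by rewrite mulVf// gt_eqF// enorm_gt0.
Qed.

Lemma enorm_normalizeE u : u = enorm u *: normalize u.
Proof.
have [->|u0] := eqVneq u 0; first by rewrite enorm0 scale0r.
by rewrite /normalize scalerA divff ?scale1r// gt_eqF// enorm_gt0.
Qed.

Lemma orthobasis t x : enorm t = 1 ->
  x = dot t x *: t + dot (perp t) x *: perp t.
Proof.
move=> /(enorm_eqP _ ler01); rewrite expr1n dotE => h.
by apply: rV2P; rewrite !mxE/= !dotE !mxE/= -[LHS]mulr1 -h; ring.
Qed.

End plane_algebra.

(** * One-dimensional Hausdorff measure *)

Section hausdorff_outer_measure.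
Variable R : realType.
Implicit Types (A B C X : set 'rV[R]_2) (x y : 'rV[R]_2) (delta : R).
Local Open Scope ereal_scope.

Lemma diam_ge0 A : 0 <= diam A.
Proof. by apply: le_ereal_sup_tmp; exists 0 => //; left. Qed.

Lemma le_diam A B : A `<=` B -> diam A <= diam B.
Proof.
move=> AB; apply: ereal_sup_le => _ [->|[x Ax [y Ay <-]]]; first by left.
by right; apply: (ex_intro2 _ _ x (AB x Ax)); exists y => //; exact: AB.
Qed.

Lemma diam_set0 : diam (set0 : set 'rV[R]_2) = 0.
Proof.
apply/eqP; rewrite eq_le diam_ge0 andbT; apply: ge_ereal_sup.
by move=> _ [->|[x []]].
Qed.

Lemma diam_leP A (a : \bar R) : 0 <= a ->
  (forall x y, A x -> A y -> (enorm (x - y))%:E <= a) -> diam A <= a.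
Proof.
by move=> a0 h; apply: ge_ereal_sup => _ [->//|[x Ax [y Ay <-]]]; exact: h.
Qed.

Lemma enorm_le_diam A x y : A x -> A y -> (enorm (x - y))%:E <= diam A.
Proof.
move=> Ax Ay; apply: ereal_sup_ubound; right.
by apply: (ex_intro2 _ _ x Ax); exists y.
Qed.

(** Moves the mesh condition on covers into the weight: a cover with a set that is too wide costs
    +oo and does not affect the infimum. *)
Definition diam_upto delta A : \bar R :=
  if diam A <= delta%:E then diam A else +oo.

Lemma diam_upto_ge0 delta A : 0 <= diam_upto delta A.
Proof. by rewrite /diam_upto; case: ifP => // _; exact: diam_ge0. Qed.

Lemma diam_upto_set0 delta : (0 < delta)%R -> diam_upto delta set0 = 0.
Proof. by move=> d0; rewrite /diam_upto diam_set0 lee_fin ltW. Qed.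

(* The sets of the covers are arbitrary, so the library's outer measure
   construction applies over the discrete sigma-algebra. *)
Lemma hausdorff1_preE delta A : hausdorff1_pre delta A =
  mu_ext (T := g_sigma_algebraType [set: set 'rV[R]_2]) (diam_upto delta) A.
Proof.
apply/eqP; rewrite eq_le; apply/andP; split;
  apply: le_ereal_inf_tmp => _ [U [dU AU] <-].
- have [{}dU|] := pselect (forall k, diam (U k) <= delta%:E).
    apply: ereal_inf_lbound; exists U => //.
    by apply: eq_eseriesr => k _; rewrite /diam_upto dU.
  move=> /existsNP[k dk]; rewrite (nneseries_pinfty (k := k)) ?leey//.
    by move=> m _; exact: diam_upto_ge0.
  by rewrite /diam_upto; case: ifPn.
- apply: ereal_inf_lbound; exists U.
    by split=> // k; exact: sub_sigma_algebra.
  by apply: eq_eseriesr => k _; rewrite /diam_upto dU.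
Qed.

Lemma hausdorff1_pre_ge0 delta A : 0 <= hausdorff1_pre delta A.
Proof. by rewrite hausdorff1_preE; apply: mu_ext_ge0; exact: diam_upto_ge0. Qed.

Lemma le_hausdorff1_pre delta A B : A `<=` B ->
  hausdorff1_pre delta A <= hausdorff1_pre delta B.
Proof. by move=> AB; rewrite !hausdorff1_preE; exact: le_mu_ext. Qed.

Lemma ge_hausdorff1_pre (delta delta' : R) A : (delta <= delta')%R ->
  hausdorff1_pre delta' A <= hausdorff1_pre delta A.
Proof.
move=> dd'; apply: ereal_inf_le_tmp => _ [U [dU AU] <-]; exists U => //.
by split=> // k; rewrite (le_trans (dU k))// lee_fin.
Qed.

Lemma hausdorff1_pre_le delta A : (0 < delta)%R ->
  hausdorff1_pre delta A <= hausdorff1 A.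
Proof. by move=> d0; apply: ereal_sup_ubound; exists delta. Qed.

Lemma hausdorff1_leP A (a : \bar R) :
  (forall delta, (0 < delta)%R -> hausdorff1_pre delta A <= a) ->
  hausdorff1 A <= a.
Proof. by move=> h; apply: ge_ereal_sup => _ [d d0 <-]; exact: h. Qed.

Lemma hausdorff1_ge0 A : 0 <= hausdorff1 A.
Proof.
exact: le_trans (hausdorff1_pre_ge0 1 A) (hausdorff1_pre_le A ltr01).
Qed.

Lemma hausdorff1_set0 : hausdorff1 (set0 : set 'rV[R]_2) = 0.
Proof.
apply/eqP; rewrite eq_le hausdorff1_ge0 andbT; apply: hausdorff1_leP => d d0.
rewrite hausdorff1_preE mu_ext0//; first (by apply: diam_upto_set0).
exact: diam_upto_ge0.
Qed.

Lemma le_hausdorff1 : {homo @hausdorff1 R : A B / A `<=` B >-> A <= B}.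
Proof.
move=> A B AB; apply: hausdorff1_leP => d d0.
exact: le_trans (le_hausdorff1_pre d AB) (hausdorff1_pre_le B d0).
Qed.

Lemma hausdorff1_sigma_subadditive : sigma_subadditive (@hausdorff1 R).
Proof.
move=> F; apply: hausdorff1_leP => d d0.
rewrite hausdorff1_preE.
have /le_trans := mu_ext_sigma_subadditive
  (T := g_sigma_algebraType [set: set 'rV[R]_2]) (diam_upto_ge0 d) F.
apply.
apply: lee_nneseries => k _; first by rewrite -hausdorff1_preE hausdorff1_pre_ge0.
by rewrite -hausdorff1_preE; exact: hausdorff1_pre_le.
Qed.

HB.instance Definition _ := isOuterMeasure.Build R 'rV[R]_2 (@hausdorff1 R)
  hausdorff1_set0 hausdorff1_ge0 le_hausdorff1 hausdorff1_sigma_subadditive.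

(** A set of diameter at most [delta] cannot meet both [A] and [B], so every cover of the union
    splits into a cover of [A] and a cover of [B] without paying twice. *)
Lemma hausdorff1_pre_separated (delta eps : R) A B : (delta < eps)%R ->
  (forall x y, A x -> B y -> (eps <= enorm (x - y))%R) ->
  hausdorff1_pre delta A + hausdorff1_pre delta B <=
  hausdorff1_pre delta (A `|` B).
Proof.
move=> de sep; apply: le_ereal_inf_tmp => _ [U [dU ABU] <-].
have subcover C : C `<=` A `|` B ->
    hausdorff1_pre delta C <= \sum_(0 <= k <oo) diam (U k `&` C).
  move=> CAB; apply: ereal_inf_lbound; exists (fun k => U k `&` C) => //.
  split=> [k|x Cx]; first exact: le_trans (le_diam (@subIsetl _ _ _)) (dU k).
  by have [k _ Ukx] := ABU x (CAB x Cx); exists k.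
apply: le_trans (leeD (subcover A _) (subcover B _)) _ => [x Ax|x Bx| ].
- by left.
- by right.
rewrite -nneseriesD; do ?by move=> *; exact: diam_ge0.
apply: lee_nneseries => [k _ _|k _]; first by rewrite adde_ge0 ?diam_ge0.
have [[x [Ux Ax]]|/nonemptyPn ->] := pselect (U k `&` A !=set0); last first.
  by rewrite diam_set0 add0e le_diam.
have [[y [Uy By]]|/nonemptyPn ->] := pselect (U k `&` B !=set0); last first.
  by rewrite diam_set0 adde0 le_diam.
have := le_trans (enorm_le_diam Ux Uy) (dU k).
by rewrite lee_fin => /(le_trans (sep x y Ax By)) /(lt_le_trans de); rewrite ltxx.
Qed.

End hausdorff_outer_measure.

(** * Additivity on separated sets, measurability of sublevel sets *)

Section hausdorff_metric.
Variable R : realType.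
Implicit Types (A B C X : set 'rV[R]_2) (x y : 'rV[R]_2).
Local Open Scope ereal_scope.

Lemma hausdorff1_separated (eps : R) A B : (0 < eps)%R ->
  (forall x y, A x -> B y -> (eps <= enorm (x - y))%R) ->
  hausdorff1 A + hausdorff1 B <= hausdorff1 (A `|` B).
Proof.
move=> e0 sep.
have pre_le (d1 d2 : R) : (0 < d1)%R -> (0 < d2)%R ->
    hausdorff1_pre d1 A + hausdorff1_pre d2 B <= hausdorff1 (A `|` B).
  (* The premeasures grow as the mesh shrinks, so a single mesh below [eps], [d1] and [d2] serves
     both terms. *)
  move=> d10 d20; pose d := Num.min (eps / 2)%R (Num.min d1 d2).
  have d0 : (0 < d)%R by rewrite !lt_min divr_gt0// d10.
  have de : (d < eps)%R.
    by rewrite gt_min ltr_pdivrMr// ltr_pMr// ltr1n.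
  apply: le_trans (hausdorff1_pre_le _ d0).
  apply: le_trans (hausdorff1_pre_separated de sep).
  by apply: leeD; apply: ge_hausdorff1_pre; rewrite !ge_min lexx ?orbT.
have [->|ABoo] := eqVneq (hausdorff1 (A `|` B)) +oo; first exact: leey.
have fin C : C `<=` A `|` B -> hausdorff1 C \is a fin_num.
  move=> CAB; rewrite ge0_fin_numE ?hausdorff1_ge0//.
  by rewrite (le_lt_trans (le_hausdorff1 CAB))// ltey.
have finA := fin A (@subsetUl _ A B); have finB := fin B (@subsetUr _ A B).
(* The two suprema over the mesh are removed one after the other, the other term being moved across
   by subtraction; this is why finiteness was secured first. *)
rewrite -leeBrDr//; apply: hausdorff1_leP => d1 d10; rewrite leeBrDr//.
rewrite addeC -leeBrDr; last first.
  rewrite ge0_fin_numE ?hausdorff1_pre_ge0//.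
  by rewrite (le_lt_trans (hausdorff1_pre_le A d10))// -ge0_fin_numE ?hausdorff1_ge0.
apply: hausdorff1_leP => d2 d20; rewrite leeBrDr; last first.
  rewrite ge0_fin_numE ?hausdorff1_pre_ge0//.
  by rewrite (le_lt_trans (hausdorff1_pre_le A d10))// -ge0_fin_numE ?hausdorff1_ge0.
by rewrite addeC pre_le.
Qed.

(** The gap may shrink with [k]: sets are added one at a time, each at positive distance from its
    predecessors, and only finite partial sums are bounded. *)
Lemma hausdorff1_bigcup_separated (F : (set 'rV[R]_2)^nat) n :
  (forall k, exists2 eps : R, (0 < eps)%R & forall m x y, (m < k)%N ->
    F m x -> F k y -> (eps <= enorm (x - y))%R) ->
  \sum_(0 <= k < n) hausdorff1 (F k) <= hausdorff1 (\bigcup_k F k).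
Proof.
move=> sep; have : \big[setU/set0]_(0 <= k < n) F k `<=` \bigcup_k F k.
  by rewrite big_mkord -bigcup_mkord => x [k _ Fx]; exists k.
move=> /le_hausdorff1; apply: le_trans.
elim: n => [|n IH]; first by rewrite !big_nil hausdorff1_ge0.
rewrite !big_nat_recr//=; apply: le_trans (leeD IH (lexx _)) _.
have [eps eps0 sepn] := sep n; apply: (hausdorff1_separated eps0) => x y.
by rewrite big_mkord -bigcup_mkord => -[m mn Fx] Fy; exact: sepn mn Fx Fy.
Qed.

Lemma sum_doubleE (a : nat -> \bar R) n :
  \sum_(0 <= k < n.*2) a k =
  \sum_(0 <= k < n) a k.*2 + \sum_(0 <= k < n) a k.*2.+1.
Proof.
elim: n => [|n IH]; first by rewrite !big_nil adde0.
by rewrite doubleS !big_nat_recr//= IH -!addeA; congr (_ + _); rewrite addeCA.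
Qed.

(* Metric outer measures: the part of X where 0 < f is the union of
   {1 / N <= f} and of the shells {1 / (k + 2) <= f < 1 / (k + 1)}, N <= k.
   Shells of equal parity are separated, so the measures of the shells have a
   finite sum, and the tail of that sum vanishes. *)
Lemma caratheodory_lipschitz_le0 (f : 'rV[R]_2 -> R) (L : R) : (0 < L)%R ->
  (forall x y, f x - f y <= L * enorm (x - y))%R ->
  (@hausdorff1 R).-caratheodory [set x | (f x <= 0)%R].
Proof.
move=> L0 fL; set C := [set x | _].
apply: (le_caratheodory_measurable (mu := @hausdorff1 R)) => X.
rewrite -[leRHS]/(hausdorff1 X).
have [->|Xoo] := eqVneq (hausdorff1 X) +oo; first exact: leey.
pose r k : R := (k.+1%:R^-1)%R.
have r0 k : (0 < r k)%R by rewrite invr_gt0.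
have rlt j k : (j < k)%N -> (r k < r j)%R.
  by move=> jk; rewrite ltf_pV2 ?posrE// ltr_nat.
have rle j k : (j <= k)%N -> (r k <= r j)%R.
  by move=> jk; rewrite lef_pV2 ?posrE// ler_nat.
have sepf (a b : R) x y : (a <= f x)%R -> (f y <= b)%R ->
    ((a - b) / L <= enorm (x - y))%R.
  by move=> ax yb; rewrite ler_pdivrMr// mulrC (le_trans _ (fL _ _))// lerB.
pose shell k := X `&` [set x | (r k.+1 <= f x)%R /\ (f x < r k)%R].
have shell_sum s n :
    \sum_(0 <= k < n) hausdorff1 (shell (s + k.*2)%N) <= hausdorff1 X.
  apply: (@le_trans _ _ (hausdorff1 (\bigcup_k shell (s + k.*2)%N))).
    apply: (hausdorff1_bigcup_separated (F := fun k => shell (s + k.*2)%N)).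
    move=> -[|k]; first by exists 1%R.
    (* Between this shell and the earlier ones of equal parity lies the whole skipped shell
       [(s + k.*2).+1]; its width divided by the Lipschitz constant bounds the distance. *)
    exists ((r (s + k.*2).+1 - r (s + k.*2).+2) / L)%R.
      by rewrite divr_gt0// subr_gt0 rlt.
    move=> m x y; rewrite ltnS => mk [_ [fx _]] [_ [_ fy]]; apply: sepf.
      by apply: le_trans fx; rewrite rle// ltnS leq_add2l leq_double.
    by rewrite (le_trans (ltW fy))// doubleS !addnS.
  by apply: le_hausdorff1 => x [k _ []].
have shell_fin : \sum_(0 <= k <oo) hausdorff1 (shell k) < +oo.
  (* One copy of [hausdorff1 X] for the even shells and one for the odd shells. *)
  apply: (@le_lt_trans _ _ (hausdorff1 X + hausdorff1 X)); last first.
    by rewrite lte_add_pinfty// ltey.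
  apply: lime_le; first by apply: is_cvg_nneseries => *; exact: hausdorff1_ge0.
  apply: nearW => n.
  apply: (@le_trans _ _ (\sum_(0 <= k < n.*2) hausdorff1 (shell k))).
    apply: lee_sum_nneg_natr; last by rewrite -addnn leq_addr.
    by move=> *; exact: hausdorff1_ge0.
  by rewrite sum_doubleE leeD// ?(shell_sum 0%N)//; exact: (shell_sum 1%N).
have tail0 := nneseries_tail_cvg shell_fin (fun k _ => hausdorff1_ge0 (shell k)).
have Xfin : hausdorff1 X \is a fin_num.
  by rewrite ge0_fin_numE ?hausdorff1_ge0// ltey.
(* The 0 added on the right is replaced by the limit of the tails, so it suffices to prove the
   inequality with the tail from [N] as error term, for every [N]. *)
rewrite -[leRHS]add0e -leeBlDr// -(cvg_lim _ tail0)//.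
apply: lime_ge; first by apply/cvg_ex; exists 0.
apply: nearW => N; rewrite leeBlDr// [leRHS]addeC.
pose XN := X `&` [set x | (r N <= f x)%R].
have XCN : X `&` ~` C `<=` XN `|` \bigcup_(k in ~` `I_N) shell k.
  move=> x [Xx /negP]; rewrite -ltNge => fx0.
  have [rN|rN] := leP (r N) (f x); first by left.
  right; have exk : exists k, (r k.+1 <= f x)%R.
    have [k] := ltr_add_invr fx0; rewrite add0r => /ltW rk.
    by exists k; rewrite (le_trans _ rk)// rle.
  case: (ex_minnP exk) => k rk kmin; exists k.
    move=> /= kN; have := le_lt_trans rk rN.
    by rewrite ltNge rle.
  split=> //; split=> //; rewrite ltNge; apply/negP => rkx.
  (* For index 0 minimality says nothing; the upper bound then comes from [f x < r N] and
     [r N <= r 0]. *)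
  case: k rk kmin rkx => [|k] rk kmin rkx; last first.
    by have := kmin k rkx; rewrite ltnn.
  by have := le_lt_trans (le_trans (rle _ _ (leq0n N)) rkx) rN; rewrite ltxx.
have sepN : hausdorff1 (X `&` C) + hausdorff1 XN <= hausdorff1 X.
  rewrite addeC; apply: (le_trans (hausdorff1_separated (eps := (r N / L)%R) _ _)).
  - by rewrite divr_gt0.
  - by move=> x y [_ fx] [_ fy]; rewrite -(subr0 (r N)); exact: sepf.
  - by apply: le_hausdorff1 => x [[]|[]].
apply: le_trans (leeD (lexx _) (le_trans (le_hausdorff1 XCN) _)) _.
  exact: (outer_measureU2 (@hausdorff1 R)).
rewrite addeA; apply: leeD => //.
exact: (outer_measure_sigma_subadditive_tail (@hausdorff1 R)).
Qed.

End hausdorff_metric.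

(** * Lengths of curves, segments and the circle *)

Section hausdorff_curves.
Variable R : realType.
Implicit Types (A B C X : set 'rV[R]_2) (x y p q : 'rV[R]_2).
Local Open Scope ereal_scope.

Lemma hausdorff1U A B : hausdorff1 (A `|` B) <= hausdorff1 A + hausdorff1 B.
Proof. exact: (outer_measureU2 (@hausdorff1 R)). Qed.

Lemma hausdorff1_nonexpansive (f : 'rV[R]_2 -> 'rV[R]_2) A :
  (forall x y, (enorm (f x - f y) <= enorm (x - y))%R) ->
  hausdorff1 (f @` A) <= hausdorff1 A.
Proof.
move=> fle; have diamf U : diam (f @` U) <= diam U.
  apply: diam_leP; first exact: diam_ge0.
  move=> _ _ [x Ux <-] [y Uy <-].
  by apply: le_trans (enorm_le_diam Ux Uy); rewrite lee_fin.
apply: hausdorff1_leP => d d0; apply: le_trans (hausdorff1_pre_le A d0).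
apply: le_ereal_inf_tmp => _ [U [dU AU] <-].
apply: (@le_trans _ _ (\sum_(0 <= k <oo) diam (f @` U k))).
  apply: ereal_inf_lbound; exists (fun k => f @` U k) => //; split=> [k|].
    exact: le_trans (diamf _) (dU k).
  by move=> _ [x /AU[k _ Ux] <-]; exists k => //; exists x.
by apply: lee_nneseries => [k _ _|k _]; [exact: diam_ge0|exact: diamf].
Qed.

Lemma hausdorff1_isometry (f g : 'rV[R]_2 -> 'rV[R]_2) A : cancel f g ->
  (forall x y, enorm (f x - f y) = enorm (x - y))%R ->
  (forall x y, enorm (g x - g y) = enorm (x - y))%R ->
  hausdorff1 (f @` A) = hausdorff1 A.
Proof.
move=> fgK fE gE; apply/eqP; rewrite eq_le; apply/andP; split.
  by apply: hausdorff1_nonexpansive => x y; rewrite fE.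
have {1}-> : A = g @` (f @` A).
  by rewrite image_comp (_ : g \o f = id) ?image_id//; exact/funext.
by apply: hausdorff1_nonexpansive => x y; rewrite gE.
Qed.

Lemma hausdorff1_translate v A : hausdorff1 (+%R v @` A) = hausdorff1 A.
Proof.
apply: (hausdorff1_isometry (g := fun x => (x - v)%R)) => [x|x y|x y].
- by rewrite addrC addKr.
- by rewrite opprD addrACA subrr add0r.
- by rewrite opprB addrA subrK.
Qed.

(** Cutting the unit interval into m equal pieces with L / m at most the mesh gives m sets of
    diameter at most L / m, of total cost L. *)
Lemma hausdorff1_curve (f : R -> 'rV[R]_2) (L : R) : (0 <= L)%R ->
  (forall s t, (enorm (f s - f t) <= L * `|s - t|)%R) ->
  hausdorff1 (f @` `[0%R, 1%R]) <= L%:E.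
Proof.
move=> L0 fL; apply: hausdorff1_leP => d d0.
have [m [m0 Lm]] : exists m, (0 < m)%N /\ (L / m%:R <= d)%R.
  exists (Num.bound (L / d)).+1; split=> //.
  rewrite ler_pdivrMr// mulrC -ler_pdivrMr//.
  have /ltW/le_trans := archi_boundP (divr_ge0 L0 (ltW d0)); apply.
  by rewrite ler_nat.
have m0R : (0 < m%:R :> R)%R by rewrite ltr0n.
pose U k : set 'rV[R]_2 := if (k < m)%N then
  f @` [set t | (k%:R / m%:R <= t <= k.+1%:R / m%:R)%R] else set0.
have dU k : diam (U k) <= (L / m%:R)%:E.
  rewrite /U; case: ifP => _; last first.
    by rewrite diam_set0 lee_fin divr_ge0// ltW.
  apply: diam_leP; first by rewrite lee_fin divr_ge0// ltW.
  move=> _ _ [s /andP[s1 s2] <-] [t /andP[t1 t2] <-].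
  rewrite lee_fin (le_trans (fL _ _))// ler_wpM2l//.
  have : (k.+1%:R / m%:R - k%:R / m%:R = m%:R^-1 :> R)%R.
    by rewrite -mulrBl -natrB// subSnn mul1r.
  by rewrite ler_norml; lra.
apply: (@le_trans _ _ (\sum_(0 <= k <oo) diam (U k))).
  apply: ereal_inf_lbound; exists U => //; split=> [k|_ [t + <-]].
    by rewrite (le_trans (dU k))// lee_fin.
  rewrite /= in_itv/= => /andP[t0 t1].
  have mt0 : (0 <= m%:R * t)%R by rewrite mulr_ge0// ltW.
  have [mt|mt] := ltnP (Num.truncn (m%:R * t)%R) m.
    exists (Num.truncn (m%:R * t)%R) => //; rewrite /U mt; exists t => //=.
    have /andP[h1 h2] := truncn_itv mt0.
    by rewrite ler_pdivrMr// ler_pdivlMr// (mulrC t) h1 ltW.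
  (* Only t = 1 is left; truncation would give the index m, but t lies in the last closed piece. *)
  exists m.-1 => //; rewrite /U prednK// leqnn; exists t => //=.
  have : (m%:R <= m%:R * t)%R.
    by have /andP[h1 h2] := truncn_itv mt0; rewrite (le_trans _ h1)// ler_nat.
  rewrite ler_pMr// => t1'; rewrite divff ?gt_eqF// t1 andbT.
  by rewrite (le_trans _ t1')// ler_pdivrMr// mul1r ler_nat leq_pred.
rewrite (nneseries_split 0 m); last by move=> *; exact: diam_ge0.
rewrite eseries0 ?adde0; last first.
  by move=> k; rewrite add0n => mk _; rewrite /U ltnNge mk diam_set0.
apply: le_trans (lee_sum _ (fun k _ => dU k)) _.
rewrite sumEFin lee_fin add0n big_const_nat subn0 iter_addr addr0.
by rewrite -[X in (X <= _)%R]mulr_natr divfK// gt_eqF.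
Qed.

Lemma hausdorff1_set1 x : hausdorff1 [set x] = 0.
Proof.
apply/eqP; rewrite eq_le hausdorff1_ge0 andbT.
apply: le_trans (hausdorff1_curve (f := cst x) (lexx 0%R) _); last first.
  by move=> s t; rewrite subrr enorm0 mul0r.
by apply: le_hausdorff1 => _ ->; exists 0%R => //=; rewrite in_itv/= lexx ler01.
Qed.

(** A 1-Lipschitz function maps each set of a cover into an interval no longer than its diameter,
    and these intervals cover [0, L]; countable subadditivity of Lebesgue measure concludes. *)
Lemma hausdorff1_project (g : 'rV[R]_2 -> R) (L : R) A : (0 <= L)%R ->
  (forall x y, (g x - g y <= enorm (x - y))%R) ->
  `[0%R, L]%classic `<=` g @` A -> L%:E <= hausdorff1 A.
Proof.
move=> L0 gL LA; apply: le_trans (hausdorff1_pre_le A ltr01).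
apply: le_ereal_inf_tmp => _ [U [dU AU] <-].
have dfin k : diam (U k) \is a fin_num.
  by rewrite ge0_fin_numE ?diam_ge0// (le_lt_trans (dU k))// ltry.
pose a k := inf (g @` U k).
pose I k := `[a k, (a k + fine (diam (U k)))%R]%classic.
have lamI k : lebesgue_measure (I k) = diam (U k).
  rewrite lebesgue_measure_itv/= lte_fin.
  case: ltP => [_|]; first by rewrite -EFinD addrAC subrr add0r fineK.
  rewrite gerDl => h; apply/eqP; rewrite eq_le diam_ge0/=.
  by rewrite -(fineK (dfin k)) lee_fin.
under eq_eseriesr do rewrite -lamI.
apply: (@le_trans _ _ (lebesgue_measure `[0%R, L]%classic)).
  rewrite lebesgue_measure_itv/= lte_fin; case: ltP => [_|].
    by rewrite sube0.
  by rewrite lee_fin.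
apply: measure_sigma_subadditive => // [k|t /LA[x /AU[k _ Ux] <-]].
  exact: measurable_itv.
exists k => //; rewrite /I /= in_itv/=.
have gdist y : U k y -> (g x - fine (diam (U k)) <= g y)%R.
  move=> Uy; rewrite lerBlDr -lerBlDl (le_trans (gL _ _))//.
  by rewrite -lee_fin fineK// enorm_le_diam.
apply/andP; split.
  apply: ge_inf; last by exists x.
  by exists (g x - fine (diam (U k)))%R => _ [y Uy <-]; exact: gdist.
rewrite -lerBlDr; apply: lb_le_inf; first by exists (g x), x.
by move=> _ [y Uy <-]; exact: gdist.
Qed.

Definition open_segment p q : set 'rV[R]_2 :=
  [set (p + t *: (q - p))%R | t in `]0%R, 1%R[%classic].

Lemma hausdorff1_open_segment p q : p != q ->
  hausdorff1 (open_segment p q) = (enorm (q - p))%:E.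
Proof.
move=> pq; pose f t : 'rV[R]_2 := (p + t *: (q - p))%R.
have L0 : (0 < enorm (q - p))%R by rewrite enorm_gt0 subr_eq0 eq_sym.
apply/eqP; rewrite eq_le; apply/andP; split.
  apply: le_trans (hausdorff1_curve (f := f) (ltW L0) _); last first.
    by move=> s t; rewrite opprD addrACA subrr add0r -scalerBl enormZ mulrC.
  apply: le_hausdorff1 => _ [t + <-]; rewrite /= in_itv/= => /andP[t0 t1].
  by exists t => //; rewrite /= in_itv/= !ltW.
(* The end points, which are null, are added so that the projection onto the direction of the
   segment covers a closed interval. *)
apply: (@le_trans _ _ (hausdorff1 (open_segment p q `|` ([set p] `|` [set q])))).
  pose g x := dot (x - p)%R (normalize (q - p)).
  apply: (hausdorff1_project (g := g)); first exact: ltW.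
    move=> x y; rewrite /g -dotBl opprB addrA subrK.
    apply: le_trans (dot_le_enorm _ _) _; rewrite enorm_normalize ?mulr1//.
    by rewrite subr_eq0 eq_sym.
  move=> s; rewrite /= in_itv/= => /andP[s0 sL].
  exists (f (s / enorm (q - p))%R).
    have [->|sn0] := eqVneq s 0%R.
      by right; left; rewrite /f mul0r scale0r addr0.
    have [->|snL] := eqVneq s (enorm (q - p)).
      by right; right; rewrite /f divff ?gt_eqF// scale1r addrC subrK.
    left; exists (s / enorm (q - p))%R => //=; rewrite in_itv/=.
    have s0' : (0 < s)%R by rewrite lt_def sn0.
    by rewrite divr_gt0//= ltr_pdivrMr// mul1r lt_neqAle snL.
  rewrite /g /f addrAC subrr add0r dotZl dotZr -sqr_enorm expr2 mulrA -mulrA.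
  by rewrite mulKf ?gt_eqF// divfK ?gt_eqF.
apply: le_trans (hausdorff1U _ _) _.
rewrite -[leRHS]adde0 leeD2l//; apply: le_trans (hausdorff1U _ _) _.
by rewrite !hausdorff1_set1 adde0.
Qed.

Definition unit_circle : set 'rV[R]_2 := [set u | enorm u = 1%R].

(* Each half circle is the image of [-1, 1] under the stereographic
   parametrisation, which is 2-Lipschitz. *)
Lemma hausdorff1_circle_fin : hausdorff1 unit_circle \is a fin_num.
Proof.
rewrite ge0_fin_numE ?hausdorff1_ge0//.
(* The parameter s in [0, 1] is rescaled to t = 2 s - 1; the Lipschitz constant 2 in t becomes 4 in
   s. *)
pose f (s : R) : 'rV[R]_2 := \row_k (let t := 2 * s - 1 in
  if k == 0 then (1 - t ^+ 2) / (1 + t ^+ 2) else 2 * t / (1 + t ^+ 2))%R.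
have half : hausdorff1 (f @` `[0%R, 1%R]) <= 4%:E.
  apply: hausdorff1_curve => // s t.
  rewrite enorm_le ?mulr_ge0// exprMn real_normK ?num_real// dotE !mxE/=.
  set a := (2 * s - 1)%R; set b := (2 * t - 1)%R.
  have a1 : (1 <= 1 + a ^+ 2)%R by rewrite lerDl sqr_ge0.
  have b1 : (1 <= 1 + b ^+ 2)%R by rewrite lerDl sqr_ge0.
  have -> : ((s - t) ^+ 2 = (a - b) ^+ 2 / 4)%R by rewrite /a /b; field.
  (* The squared chord between the points of stereographic parameters a and b. *)
  rewrite (_ : (_ + _)%R =
    (4 * (a - b) ^+ 2 / ((1 + a ^+ 2) * (1 + b ^+ 2)))%R); last first.
    by field; rewrite !gt_eqF//; apply: lt_le_trans ltr01 _.
  have ab1 : (1 <= (1 + a ^+ 2) * (1 + b ^+ 2))%R by nra.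
  rewrite ler_pdivrMr; last exact: lt_le_trans ltr01 ab1.
  by have := sqr_ge0 (a - b); nra.
apply: (@le_lt_trans _ _ (4%:E + 4%:E)); last by rewrite -EFinD ltry.
apply: le_trans (leeD half half).
apply: (@le_trans _ _
  (hausdorff1 (f @` `[0%R, 1%R] `|` -%R @` (f @` `[0%R, 1%R])))).
  have cover u : unit_circle u -> (0 <= u 0 0)%R -> (f @` `[0%R, 1%R]) u.
    move=> /(enorm_eqP _ ler01); rewrite expr1n dotE => u1 u0.
    have pos : (0 < 1 + u 0 0)%R by rewrite ltr_pwDl.
    (* The inverse parametrisation is t = y / (1 + x); on the right half circle it takes values in
       [-1, 1]. *)
    exists ((1 + u 0 1 / (1 + u 0 0)) / 2)%R.
      rewrite /= in_itv/=; apply/andP; split.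
        by rewrite divr_ge0// -lerBlDl sub0r ler_pdivlMr//; nra.
      by rewrite ler_pdivrMr// mul1r -lerBrDl ler_pdivrMr//; nra.
    set x := (u 0 0)%R in u1 u0 pos *; set y := (u 0 1)%R in u1 *.
    have xy : ((1 + x) ^+ 2 + y ^+ 2 = 2 * (1 + x))%R by nra.
    have h1 : (1 + x != 0)%R by rewrite gt_eqF.
    have tE : (2 * ((1 + y / (1 + x)) / 2) - 1 = y / (1 + x))%R by field.
    have t2 : (1 + (y / (1 + x)) ^+ 2 = 2 / (1 + x))%R.
      rewrite expr_div_n -[X in (X + _)%R](divff (expf_neq0 2 h1)) -mulrDl xy.
      by field.
    apply: rV2P; rewrite mxE /= tE t2 -/x -/y; last by field.
    rewrite (_ : 1 - _ = 2 - 2 / (1 + x))%R; last by rewrite -t2; ring.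
    by field.
  apply: le_hausdorff1 => u cu.
  have [u0|u0] := leP 0%R (u 0 0)%R; first by left; exact: cover.
  right; exists (- u)%R; last by rewrite opprK.
  by apply: cover; [rewrite /unit_circle/= enormN|rewrite mxE oppr_ge0 ltW].
apply: le_trans (hausdorff1U _ _) _.
rewrite leeD2l//; apply: hausdorff1_nonexpansive => x y.
by rewrite -opprD enormN.
Qed.

End hausdorff_curves.

(** * Convex sets in the plane *)

Section convexity.
Variable R : realType.
Implicit Types (A B : set 'rV[R]_2) (u v w x y z : 'rV[R]_2) (s t a : R).

Lemma convex_setP A : @convex_set R 'rV[R]_2 A <->
  forall x y t, A x -> A y -> 0 <= t <= 1 -> A (x + t *: (y - x)).
Proof.
have mixE x y t : x + t *: (y - x) = t *: y + (1 - t) *: x.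
  by rewrite scalerBl scale1r scalerBr addrCA.
split=> [cA x y t Ax Ay /andP[t0 t1]|cA x y k Ax Ay].
  rewrite mixE.
  exact: set_mem (cA y x (Itv01 t0 t1) (mem_set Ay) (mem_set Ax)).
apply/mem_set; rewrite -[X in A X]/(k%:num *: x + (1 - k%:num) *: y) -mixE.
by apply: cA; [exact: set_mem|exact: set_mem|rewrite ge0 le1].
Qed.

Lemma conv_hull_convex A x y t : conv_hull A x -> conv_hull A y -> 0 <= t <= 1 ->
  conv_hull A (x + t *: (y - x)).
Proof.
move=> Ax Ay t01 B [cB AB]; have /convex_setP := cB; apply=> //.
- exact: Ax.
- exact: Ay.
Qed.

Lemma conv_hull_min A B :
  (forall x y t, B x -> B y -> 0 <= t <= 1 -> B (x + t *: (y - x))) ->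
  A `<=` B -> conv_hull A `<=` B.
Proof. by move=> /convex_setP cB AB; exact: smallest_sub. Qed.

Lemma sub_conv_hull A : A `<=` conv_hull A.
Proof. exact: sub_gen_smallest. Qed.

Lemma conv_hull_halfplane A w a :
  (forall x, A x -> dot x w <= a) -> forall x, conv_hull A x -> dot x w <= a.
Proof.
move=> Aw; apply: conv_hull_min => // x y t xa ya /andP[t0 t1].
rewrite dotDl dotZl dotBl; nra.
Qed.

(** Lexicographic half planes are convex. They let a maximum with a tie-breaking rule pass from the
    centres to their hull. *)
Lemma conv_hull_lex A v w a b :
  (forall x, A x -> dot x v < a \/ dot x v = a /\ dot x w <= b) ->
  forall x, conv_hull A x -> dot x v < a \/ dot x v = a /\ dot x w <= b.
Proof.
move=> Avw; apply: conv_hull_min => // x y t; rewrite !dotDl !dotZl !dotBl.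
move=> hx hy /andP[].
rewrite le_eqVlt => /predU1P[<-|t0]; first by rewrite !mul0r !addr0.
rewrite le_eqVlt => /predU1P[->|t1].
  by rewrite !mul1r !(addrC _ (_ - _)) !subrK.
case: hx => [hx|[hx hx']]; case: hy => [hy|[hy hy']].
all: by [left; nra|right; nra].
Qed.

(** The sum of the two normality inequalities, taken at [y'] and at [y], says that |y - y'|^2 is at
    most 0. It makes the decomposition of a boundary point into foot and normal unique. *)
Lemma nearest_point_uniq A y y' v v' : A y -> A y' ->
  (forall z, A z -> dot (z - y) v <= 0) ->
  (forall z, A z -> dot (z - y') v' <= 0) ->
  y + v = y' + v' -> y = y'.
Proof.
move=> Ay Ay' yv yv' e; apply/eqP; rewrite -subr_eq0; apply/eqP/dot_eq0.
have h1 := yv _ Ay'; have h2 := yv' _ Ay.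
have e' : y - y' = v' - v.
  by rewrite -[v'](addKr y') -e addrA addrK addrC.
have : dot (y - y') (v' - v) <= 0.
  by rewrite dotBr; move: h1; rewrite -opprB -scaleN1r dotZl; lra.
by rewrite -e' => h; apply/eqP; rewrite eq_le h dot_ge0.
Qed.

Lemma nearest_point_normal A x y :
  (forall u v t, A u -> A v -> 0 <= t <= 1 -> A (u + t *: (v - u))) ->
  A y -> (forall z, A z -> enorm (x - y) <= enorm (x - z)) ->
  forall z, A z -> dot (z - y) (x - y) <= 0.
Proof.
move=> cA Ay ymin z Az; rewrite leNgt; apply/negP => h.
set d := dot _ _ in h; set D := dot (z - y) (z - y).
have D0 : 0 <= D := dot_ge0 _.
(* Moving from y towards z by t lowers the squared distance to x by t (2 d - t D). This t lies in
   (0, 1], also for D = 0, and satisfies t D < d. *)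
pose t := d / (d + D).
have t01 : 0 < t <= 1.
  by rewrite divr_gt0 ?ltr_pwDl//= ler_pdivrMr ?mul1r ?lerDl ?ltr_pwDl.
have t01' : 0 <= t <= 1 by case/andP: t01 => /ltW -> ->.
have := ymin _ (cA _ _ _ Ay Az t01').
rewrite opprD addrA enorm_le ?enorm_ge0// sqr_enorm.
have -> : dot (x - y - t *: (z - y)) (x - y - t *: (z - y)) =
    dot (x - y) (x - y) - t * (2 * d - t * D).
  by rewrite /d /D !dotE !mxE; ring.
case/andP: t01 => t0 t1; rewrite lerBrDr gerDl pmulr_rle0//.
have : t * (d + D) = d by rewrite divfK// gt_eqF// ltr_pwDl.
by nra.
Qed.

Lemma nbhs_segment (A : set 'rV[R]_2) x v : nbhs x A ->
  exists2 t, 0 < t & A (x + t *: v).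
Proof.
move=> Ax; have : (fun t : R => x + t *: v) t @[t --> (0 : R)] --> x.
  have {2}-> : x = x + 0 *: v by rewrite scale0r addr0.
  apply: cvgD; first exact: cvg_cst.
  by apply: cvgZr_tmp; exact: cvg_id.
move=> /(_ _ Ax)/= [e /= e0 he]; exists (e / 2); first by rewrite divr_gt0.
apply: he; rewrite /ball/= sub0r normrN gtr0_norm ?divr_gt0//.
by rewrite ltr_pdivrMr// ltr_pMr// ltr1n.
Qed.

Lemma nbhs_enorm x (r : R) : 0 < r ->
  nbhs x [set y : 'rV[R]_2 | enorm (y - x) < r].
Proof.
(* Coordinates below r / 2 give a squared Euclidean norm below r^2 / 2. *)
move=> r0; apply/nbhs_ballP; exists (r / 2); first by rewrite /= divr_gt0.
move=> y xy; have h k : `|(y - x) 0 k| < r / 2.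
  case: xy => _ /(_ 0 k); rewrite /ball/= distrC mxE.
  by rewrite mxE.
rewrite /= ltNge; apply/negP; rewrite leNgt => /negP; apply.
rewrite ltNge -(@ler_sqr _ r) ?nnegrE ?enorm_ge0 ?(ltW r0)// -ltNge sqr_enorm dotE.
have := h 0; have := h 1; rewrite !ltr_norml => /andP[h1 h2] /andP[h3 h4].
by nra.
Qed.

Lemma continuous_dot w : continuous (fun x => dot x w).
Proof.
move=> x; rewrite (_ : (fun x => _) =
  (fun x : 'rV[R]_2 => x 0 0 * w 0 0 + x 0 1 * w 0 1)); last first.
  by apply/funext => y; rewrite dotE.
have cc k : {for x, continuous (fun y : 'rV[R]_2 => y 0 k * w 0 k)}.
  apply: (@continuousM R _ (fun y : 'rV[R]_2 => y 0 k) (cst (w 0 k))).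
    exact: coord_continuous.
  exact: cst_continuous.
exact: (continuousD (cc 0) (cc 1)).
Qed.

Lemma closed_halfplane w a : closed [set x | dot x w <= a].
Proof.
have /continuous_closedP/(_ [set r | r <= a]) := @continuous_dot w.
by apply; exact: closed_le.
Qed.

End convexity.

(** * Barycentric coordinates and nearest points *)

Section finite_hull.
Variables (R : realType) (n : nat).
Implicit Types (c : config R n) (l : 'rV[R]_n).

Definition simplex : set 'rV[R]_n :=
  [set l | (forall i, 0 <= l 0 i) /\ \sum_i l 0 i = 1].

Lemma continuous_linear_form m (a : 'I_m -> R) :
  continuous (fun l : 'rV[R]_m => \sum_i l 0 i * a i).
Proof.
apply: continuous_big => [|i _]; first exact: add_continuous.
move=> l; apply: (@continuousM R _ (fun l : 'rV[R]_m => l 0 i) (cst (a i))).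
  exact: coord_continuous.
exact: cst_continuous.
Qed.

Lemma simplex_compact : compact simplex.
Proof.
apply: (@subclosed_compact _ _
  [set l : 'rV[R]_n | forall i, `[0, 1]%classic (l ord0 i)]).
- rewrite (_ : simplex = \bigcap_i ((fun l : 'rV[R]_n => l 0 i) @^-1` [set x | 0 <= x])
    `&` ((fun l : 'rV[R]_n => \sum_i l 0 i * 1) @^-1` [set x | x = 1])); last first.
    apply/seteqP; split=> l /=.
      move=> [l0 l1]; split; first by move=> i _; exact: l0.
      by under eq_bigr do rewrite mulr1.
    move=> [l0 l1]; split; first by move=> i; exact: l0.
    by rewrite -l1; apply: eq_bigr => i _; rewrite mulr1.
  apply: closedI.
    apply: closed_bigI => i _; apply: preimage_closed; last exact: closed_ge.
    by move=> l _; exact: coord_continuous.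
  apply: preimage_closed; last exact: closed_eq.
  by move=> l _; exact: (@continuous_linear_form n (fun=> 1) l).
- by apply: (@rV_compact R n (fun=> `[0, 1]%classic)) => i; exact: segment_compact.
- move=> l [l0 l1] i /=; rewrite in_itv/= l0/= -l1.
  by rewrite (bigD1 i)//= lerDl sumr_ge0.
Qed.

Lemma simplex_centre_hull c l : simplex l -> centre_hull c (l *m c).
Proof.
move=> [l0 l1]; rewrite mulmx_sum_row.
have [i0 _|noI] := pickP (fun _ : 'I_n => true); last first.
  by move: l1; rewrite big1 => [/esym/eqP|i _]; [rewrite oner_eq0|have := noI i].
(* A partial sum is recorded as its total weight times a hull point, which avoids dividing by a
   weight that may still be 0. *)
have hullP (s : seq 'I_n) : exists2 y, centre_hull c y &
    \sum_(i <- s) l 0 i *: row i c = (\sum_(i <- s) l 0 i) *: y.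
  elim: s => [|i s [y Py ysum]].
    exists (row i0 c); last by rewrite !big_nil scale0r.
    by apply: sub_conv_hull; exists i0.
  rewrite !big_cons ysum; set a := \sum_(_ <- _) _.
  have a0 : 0 <= a by exact: sumr_ge0.
  have [s0|s0] := eqVneq (l 0 i + a) 0.
    have [li aE] : l 0 i = 0 /\ a = 0 by have := l0 i; lra.
    by exists y => //; rewrite s0 li aE !scale0r addr0.
  have sp : 0 < l 0 i + a by rewrite lt_def s0 addr_ge0.
  exists (row i c + (a / (l 0 i + a)) *: (y - row i c)).
    apply: conv_hull_convex => //; first by apply: sub_conv_hull; exists i.
    by rewrite divr_ge0 ?(ltW sp)//= ler_pdivrMr// mul1r lerDr.
  rewrite scalerDr scalerA mulrCA divff// mulr1 scalerBr scalerDl.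
  by rewrite addrACA subrr addr0.
have [y Py ->] := hullP (index_enum 'I_n).
by rewrite l1 scale1r.
Qed.

Lemma centre_hull_simplex c y : centre_hull c y -> exists2 l, simplex l & y = l *m c.
Proof.
apply: (@conv_hull_min _ _ [set y | exists2 l, simplex l & y = l *m c]); last first.
  move=> _ [i _ <-]; exists (delta_mx 0 i); last by rewrite -rowE.
  split=> [k|]; first by rewrite mxE ler0n.
  rewrite (bigD1 i)//= mxE !eqxx big1 ?addr0// => k /negbTE ki.
  by rewrite mxE ki andbF.
move=> _ _ t [l [l0 l1] ->] [m [m0 m1] ->] /andP[t0 t1].
exists (l + t *: (m - l)); last by rewrite mulmxDl -scalemxAl mulmxBl.
split=> [i|].
  by rewrite !mxE; have := l0 i; have := m0 i; nra.
under eq_bigr do rewrite !mxE.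
by rewrite big_split/= -mulr_sumr sumrB l1 m1 subrr mulr0 addr0.
Qed.

(** The hull is the image of the compact simplex under a continuous map, so the squared distance to
    [x] attains its minimum on it. *)
Lemma nearest_point c x : (0 < n)%N -> exists2 y, centre_hull c y &
  forall z, centre_hull c z -> dot (z - y) (x - y) <= 0.
Proof.
move=> n0; pose f l := dot (x - l *m c) (x - l *m c).
have fc : continuous f.
  have coordc (k : 'I_2) : continuous (fun l : 'rV[R]_n => (x - l *m c) 0 k).
    have -> : (fun l : 'rV[R]_n => (x - l *m c) 0 k) =
        (fun l : 'rV[R]_n => x 0 k - \sum_i l 0 i * c i k).
      by apply/funext => l; rewrite !mxE.
    move=> l; apply: (@continuousB _ _ _ (cst (x 0 k))).
      exact: cst_continuous.
    exact: continuous_linear_form.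
  move=> l; rewrite (_ : f = fun l => (x - l *m c) 0 0 * (x - l *m c) 0 0 +
      (x - l *m c) 0 1 * (x - l *m c) 0 1); last by apply/funext => m; rewrite /f dotE.
  exact: (continuousD (continuousM (coordc 0 l) (coordc 0 l))
    (continuousM (coordc 1 l) (coordc 1 l))).
have S0 : simplex !=set0.
  exists (delta_mx 0 (Ordinal n0)); split=> [k|]; first by rewrite mxE ler0n.
  rewrite (bigD1 (Ordinal n0))//= mxE !eqxx big1 ?addr0// => k /negbTE ki.
  by rewrite mxE ki andbF.
have [l /set_mem Sl lmin] :=
  compact_EVT_min S0 simplex_compact (continuous_subspaceT fc).
have Pl := @simplex_centre_hull c l Sl; exists (l *m c) => //.
apply: nearest_point_normal => // [u v t|z]; first exact: conv_hull_convex.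
move=> /centre_hull_simplex[m Sm ->]; rewrite enorm_le ?enorm_ge0// sqr_enorm.
exact/lmin/mem_set.
Qed.

End finite_hull.

(** * Boundary of the hull of the disks *)

Section hull_boundary.
Variables (R : realType) (n : nat) (c : config R n).
Implicit Types (u v x y z : 'rV[R]_2) (i p q : 'I_n).

Let P := centre_hull c.

Lemma row_centre_hull i : P (row i c).
Proof. by apply: sub_conv_hull; exists i. Qed.

Lemma centre_hull_halfplane v (a : R) : (forall i, dot (row i c) v <= a) ->
  forall x, P x -> dot x v <= a.
Proof. by move=> ca; apply: conv_hull_halfplane => _ [i _ <-]; exact: ca. Qed.

Definition normal_cone y : set 'rV[R]_2 :=
  [set v | forall z, P z -> dot (z - y) v <= 0].

Definition disk_hull : set 'rV[R]_2 := conv_hull (\bigcup_i disk (row i c)).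

Lemma disk_hull_halfplane y v : enorm v <= 1 -> normal_cone y v ->
  forall x, disk_hull x -> dot (x - y) v <= enorm v.
Proof.
move=> v1 yv x Kx; rewrite dotBl lerBlDr.
move: x Kx; apply: conv_hull_halfplane => x [i _ xi].
have := yv _ (row_centre_hull i); rewrite dotBl => h.
have := dot_le_enorm (x - row i c) v; rewrite dotBl => h'.
have : enorm (x - row i c) * enorm v <= enorm v by rewrite ler_piMl// enorm_ge0.
by lra.
Qed.

Lemma sub_disk_hull y u : P y -> enorm u <= 1 -> disk_hull (y + u).
Proof.
move=> Py u1; move: y Py; apply: conv_hull_min => [x y t Kx Ky t01|_ [i _ <-]].
  have := conv_hull_convex Kx Ky t01.
  by rewrite opprD addrACA subrr addr0 addrAC.
by apply: sub_conv_hull; exists i => //; rewrite /disk/= addrAC subrr add0r.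
Qed.

(** The hull of the disks consists of the points at distance at most 1 from the centre hull, and its
    boundary of those at distance exactly 1; [y] is the nearest point of the centre hull. *)
Lemma boundary_disk_hull : (0 < n)%N -> boundary disk_hull =
  [set x | exists y u, [/\ P y, enorm u = 1, normal_cone y u & x = y + u]].
Proof.
move=> n0; apply/seteqP; split=> [x [clx nintx]|_ [y [u [Py u1 yu ->]]]].
  have [y Py yx] := nearest_point c x n0.
  exists y, (x - y); split=> //; last by rewrite addrC subrK.
  apply/eqP; rewrite eq_le; apply/andP; split; last first.
    (* At distance below 1 from [y], a small ball about x stays in the unit disk about [y], which
       makes x interior. *)
    rewrite leNgt; apply/negP => xy1; apply: nintx.
    have r0 : 0 < 1 - enorm (x - y) by rewrite subr_gt0.
    apply: filterS (nbhs_enorm x r0) => z /= zx.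
    rewrite -(subrK y z) addrC; apply: sub_disk_hull => //.
    by have := enorm_tri z x y; lra.
  (* At distance above 1, a closed half plane contains the hull of the disks but not x, which
     contradicts membership in the closure. *)
  rewrite leNgt; apply/negP => xy1.
  pose w := normalize (x - y).
  have xy0 : x - y != 0 by rewrite -enorm_gt0 (lt_trans ltr01).
  have w1 : enorm w = 1 by rewrite enorm_normalize.
  have w1' : enorm w <= 1 by rewrite w1.
  have yw : normal_cone y w.
    move=> z /yx h; rewrite dotZr mulr_ge0_le0// invr_ge0 enorm_ge0//.
  have : dot x w <= dot y w + 1.
    have Kw : disk_hull `<=` [set z | dot z w <= dot y w + 1].
      move=> z Kz /=.
      by have := disk_hull_halfplane w1' yw Kz; rewrite w1 dotBl; lra.
    exact: (@closed_halfplane _ w _ x (closureS Kw clx)).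
  have -> : dot x w = dot y w + enorm (x - y).
    rewrite -{1}(subrK y x) dotDl addrC {1}(enorm_normalizeE (x - y)) dotZl.
    by rewrite -/w -sqr_enorm w1 expr1n mulr1.
  lra.
split; first by apply: subset_closure; apply: sub_disk_hull; rewrite ?u1.
(* An interior point could be pushed further along [u], beyond the supporting line. *)
move=> /(@nbhs_segment _ _ _ u)[t t0].
move=> /(disk_hull_halfplane _ yu); rewrite u1 => /(_ (lexx _)).
rewrite addrAC [y + _]addrC addrK dotDl dotZl -sqr_enorm u1 expr1n mulr1.
lra.
Qed.

Lemma hull_vertexP i : i \in hull_vertices c <-> extreme_point P (row i c).
Proof. by rewrite inE; split=> /asboolP. Qed.

Lemma hull_edgeP p q : (p, q) \in hull_edges c <-> hull_edge c p q.
Proof. by rewrite inE; split=> /asboolP. Qed.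

Lemma extreme_open_segment i y z : i \in hull_vertices c -> P y -> P z ->
  open_segment y z (row i c) -> y = z.
Proof.
move=> /hull_vertexP[_ ext] Py Pz [t]; rewrite /= in_itv/= => t01 e.
apply: (ext y z t) => //; rewrite -e scalerBl scale1r scalerBr addrA addrAC.
by rewrite addrAC.
Qed.

(* The last hull vertex, in the direction [w], of the face of the hull with
   outer normal [v]. *)
Lemma face_end v w : (0 < n)%N -> exists i,
  (forall z, P z -> dot z v <= dot (row i c) v) /\
  (forall z, P z -> dot z v = dot (row i c) v -> dot z w <= dot (row i c) w).
Proof.
move=> n0; have [i _ imax] := @arg_maxP _ _ _ (Ordinal n0) xpredT
  (fun i => dot (row i c) v) isT.
have [j /eqP ji jmax] := @arg_maxP _ _ _ i
  (fun j => dot (row j c) v == dot (row i c) v) (fun j => dot (row j c) w) (eqxx _).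
exists j; have lex := @conv_hull_lex R (range (fun i => row i c)) v w
  (dot (row j c) v) (dot (row j c) w).
have {}lex z : P z -> dot z v < dot (row j c) v \/
    dot z v = dot (row j c) v /\ dot z w <= dot (row j c) w.
  apply: lex => _ [k _ <-]; rewrite ji.
  have := imax k isT; rewrite /= le_eqVlt => /predU1P[ki|]; last by left.
  by right; split=> //; apply: jmax; apply/eqP.
split=> z /lex[|[-> //]]; first exact: ltW.
by move=> + e; rewrite e ltxx.
Qed.

(** If [row i c] lies inside a segment of the hull, maximality for [v] puts both ends on the face,
    maximality for [w] then equalises their second coordinate, and [sep] identifies them. *)
Lemma face_end_vertex v w i :
  (forall z z', dot z v = dot z' v -> dot z w = dot z' w -> z = z') ->
  (forall z, P z -> dot z v <= dot (row i c) v) ->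
  (forall z, P z -> dot z v = dot (row i c) v -> dot z w <= dot (row i c) w) ->
  i \in hull_vertices c.
Proof.
move=> sep iv iw; apply/hull_vertexP; split; first exact: row_centre_hull.
move=> y z t Py Pz /andP[t0 t1] e.
have ev u : dot (row i c) u = (1 - t) * dot y u + t * dot z u.
  by rewrite e dotDl !dotZl.
have yv := iv _ Py; have zv := iv _ Pz; have ei := ev v.
have yvE : dot y v = dot (row i c) v by nra.
have zvE : dot z v = dot (row i c) v by nra.
have yw := iw _ Py yvE; have zw := iw _ Pz zvE; have eiw := ev w.
apply: sep; first by rewrite yvE.
by nra.
Qed.

Lemma dot_perp_inj v x y : v != 0 -> dot x v = dot y v ->
  dot x (perp v) = dot y (perp v) -> x = y.
Proof.
move=> v0 /eqP; rewrite -subr_eq0 -dotBl => /eqP h1 /eqP.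
rewrite -subr_eq0 -dotBl => /eqP h2; apply/eqP; rewrite -subr_eq0; apply/eqP/dot_eq0.
have : dot (x - y) (x - y) * dot v v = 0.
  transitivity (dot (x - y) v ^+ 2 + dot (x - y) (perp v) ^+ 2).
    by rewrite !dotE !mxE/=; ring.
  by rewrite h1 h2 expr0n addr0.
move=> /eqP; rewrite mulf_eq0 => /orP[/eqP//|/eqP/dot_eq0/eqP].
by rewrite (negbTE v0).
Qed.

(** The hull lies to the left of its oriented edges, so the outer normal is the edge direction
    turned clockwise. *)
Definition edge_normal p q : 'rV[R]_2 := - perp (udir c p q).

(** The face with outer normal [u] runs from its last vertex [p] in direction [- perp u] to its last
    vertex [q] in direction [perp u]. The point [y] lies on it, hence is an end or strictly between;
    in the latter case the face is an edge with normal [u]. *)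
Lemma hull_face y u : (0 < n)%N -> P y -> enorm u = 1 -> normal_cone y u ->
  (exists2 i, i \in hull_vertices c & y = row i c) \/
  (exists p q, [/\ (p, q) \in hull_edges c, u = edge_normal p q &
     open_segment (row p c) (row q c) y]).
Proof.
move=> n0 Py u1 yu.
have u0 : u != 0 by rewrite -enorm_gt0 u1.
have [q [qu qw]] := face_end u (perp u) n0.
have [p [pu pw]] := face_end u (- perp u) n0.
have yuE i : (forall z, P z -> dot z u <= dot (row i c) u) ->
    dot y u = dot (row i c) u.
  move=> iu; apply/eqP; rewrite eq_le iu//=.
  by have := yu _ (row_centre_hull i); rewrite dotBl subr_le0.
have yp := yuE _ pu; have yq := yuE _ qu.
have qv : q \in hull_vertices c.
  by apply: (face_end_vertex _ qu qw) => z z'; exact: dot_perp_inj.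
have pv : p \in hull_vertices c.
  apply: (face_end_vertex _ pu pw) => z z' zu.
  by rewrite !dotNr => /oppr_inj; exact: dot_perp_inj.
have := qw _ Py yq; rewrite le_eqVlt => /predU1P[yqw|yqw].
  by left; exists q => //; apply: (dot_perp_inj u0).
have := pw _ Py yp; rewrite !dotNr lerN2 le_eqVlt => /predU1P[ypw|ypw].
  by left; exists p => //; apply: (dot_perp_inj u0).
right; exists p, q.
set a := dot (row p c) (perp u) in ypw *; set b := dot (row q c) (perp u) in yqw *.
have ab : 0 < b - a by rewrite subr_gt0 (lt_trans ypw).
have uu : dot u u = 1 by rewrite -sqr_enorm u1 expr1n.
have pq : row q c - row p c = (b - a) *: perp u.
  apply: (dot_perp_inj u0).
    by rewrite dotBl -yp -yq subrr dotZl (dotC (perp u)) dot_perpr mulr0.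
  by rewrite dotBl dotZl dot_perp uu mulr1.
have dirE : udir c p q = perp u.
  rewrite /udir /normalize pq enormZ enorm_perp u1 mulr1 gtr0_norm//.
  by rewrite scalerA mulVf ?scale1r// gt_eqF.
have perpK : perp (perp u) = - u by apply: rV2P; rewrite !mxE/=.
split.
- apply/hull_edgeP; split=> //.
    by apply/eqP => epq; move: ab; rewrite /a /b epq subrr ltxx.
  move=> x Px; rewrite -dot_perpl pq.
  have -> : perp ((b - a) *: perp u) = - (b - a) *: u.
    by apply: rV2P; rewrite !mxE/=; ring.
  rewrite dotZl mulNr -mulrN mulr_ge0 ?(ltW ab)// oppr_ge0 dotC.
  by rewrite dotBl subr_le0 pu.
- by rewrite /edge_normal dirE perpK opprK.
- exists ((dot y (perp u) - a) / (b - a)).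
    have ya : 0 < dot y (perp u) - a by rewrite subr_gt0.
    rewrite /= in_itv/= divr_gt0//= ltr_pdivrMr// mul1r.
    by rewrite ltrD2r.
  apply: (dot_perp_inj u0).
    by rewrite dotDl dotZl dotBl -yp -yq subrr mulr0 addr0.
  rewrite dotDl dotZl dotBl -/a -/b divfK ?gt_eqF//.
  by rewrite addrC subrK.
Qed.

Lemma circle_normal_cone u : (0 < n)%N -> enorm u = 1 ->
  exists2 i, i \in hull_vertices c & normal_cone (row i c) u.
Proof.
move=> n0 u1; have u0 : u != 0 by rewrite -enorm_gt0 u1.
have [i [iu iw]] := face_end u (perp u) n0; exists i.
  by apply: (face_end_vertex _ iu iw) => z z'; exact: dot_perp_inj.
by move=> z Pz; rewrite dotBl subr_le0 iu.
Qed.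

Lemma open_segment_hull x y z : P x -> P y -> open_segment x y z -> P z.
Proof.
move=> Px Py [t + <-]; rewrite /= in_itv/= => /andP[t0 t1].
by apply: conv_hull_convex => //; rewrite !ltW.
Qed.

Hypothesis row_inj : injective (fun i => row i c).

Lemma enorm_edge_normal p q : p != q -> enorm (edge_normal p q) = 1.
Proof.
move=> pq; rewrite enormN enorm_perp enorm_normalize// subr_eq0.
by apply: contra pq => /eqP/row_inj ->.
Qed.

Lemma hull_edge_normal p q y t : (p, q) \in hull_edges c ->
  y = row p c + t *: (row q c - row p c) -> normal_cone y (edge_normal p q).
Proof.
move=> /hull_edgeP[_ _ _ pq] -> z Pz.
have := pq z Pz; rewrite -dot_perpl => h.
have -> : dot (z - (row p c + t *: (row q c - row p c))) (edge_normal p q) =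
    - ((enorm (row q c - row p c))^-1 * dot (perp (row q c - row p c)) (z - row p c)).
  by rewrite /edge_normal /udir /normalize !dotE !mxE/=; ring.
by rewrite oppr_le0 mulr_ge0// invr_ge0 enorm_ge0.
Qed.

Definition hull_arc i : set 'rV[R]_2 :=
  [set x | enorm (x - row i c) = 1 /\ normal_cone (row i c) (x - row i c)].

Definition hull_side (pq : 'I_n * 'I_n) : set 'rV[R]_2 :=
  open_segment (row pq.1 c + edge_normal pq.1 pq.2)
    (row pq.2 c + edge_normal pq.1 pq.2).

Lemma hull_sideP pq x : hull_side pq x <->
  exists2 y, open_segment (row pq.1 c) (row pq.2 c) y &
    x = y + edge_normal pq.1 pq.2.
Proof.
split=> [[t t01 <-]|[y [t t01 <-] ->]].
  exists (row pq.1 c + t *: (row pq.2 c - row pq.1 c)); first by exists t.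
  by rewrite opprD addrACA subrr addr0 addrAC.
by exists t => //; rewrite opprD addrACA subrr addr0 addrAC.
Qed.

Lemma boundary_arcs_sides : (0 < n)%N -> boundary disk_hull =
  (\bigcup_(i in [set` hull_vertices c]) hull_arc i) `|`
  (\bigcup_(pq in [set` hull_edges c]) hull_side pq).
Proof.
move=> n0; rewrite boundary_disk_hull//; apply/seteqP; split.
  move=> _ [y [u [Py u1 yu ->]]].
  have [[i iv e]|[p [q [pq -> ypq]]]] := hull_face n0 Py u1 yu.
    by left; exists i => //; rewrite /hull_arc/= -e addrAC subrr add0r.
  by right; exists (p, q) => //; apply/hull_sideP; exists y.
move=> x [[i iv [x1 ix]]|[[p q] pq /hull_sideP[y ypq ->]]].
  exists (row i c), (x - row i c); split=> //; first exact: row_centre_hull.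
  by rewrite addrC subrK.
exists y, (edge_normal p q); split=> //.
- by apply: open_segment_hull ypq; exact: row_centre_hull.
- by rewrite enorm_edge_normal//; case/hull_edgeP: pq.
- by case: ypq => t _ <-; exact: (hull_edge_normal pq (erefl _)).
Qed.

End hull_boundary.
Arguments row_centre_hull {R n} c i.

(** * Additivity and the perimeter formula *)

Section caratheodory_plane.
Variable R : realType.
Implicit Types (A B C X : set 'rV[R]_2) (u v w x y z : 'rV[R]_2).
Local Open Scope ereal_scope.

Let cara : set (set 'rV[R]_2) := (@hausdorff1 R).-caratheodory.

Lemma caratheodoryI A B : cara A -> cara B -> cara (A `&` B).
Proof. exact: (@caratheodory_measurable_setI _ _ (@hausdorff1 R)). Qed.

Lemma caratheodoryC A : cara A -> cara (~` A).
Proof. exact: (@caratheodory_measurable_setC _ _ (@hausdorff1 R)). Qed.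

Lemma caratheodory_bigU (I : Type) (s : seq I) (F : I -> set 'rV[R]_2) :
  (forall i, cara (F i)) -> cara (\big[setU/set0]_(i <- s) F i).
Proof.
move=> cF; elim/big_ind : _ => // [|A B cA cB].
  exact: (@caratheodory_measurable_set0 _ _ (@hausdorff1 R)).
exact: (@caratheodory_measurable_setU _ _ (@hausdorff1 R)).
Qed.

Lemma caratheodory_forall (I : finType) (F : I -> set 'rV[R]_2) :
  (forall i, cara (F i)) -> cara [set x | forall i, F i x].
Proof.
move=> cF; have -> : [set x | forall i, F i x] =
    ~` \big[setU/set0]_(i <- enum I) ~` F i.
  rewrite -bigcup_seq; apply/seteqP; split=> x.
    by move=> Fx [i _]; apply; exact: Fx.
  by move=> nF i; apply: contrapT => nFi; apply: nF; exists i => //=; rewrite mem_enum.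
by apply/caratheodoryC/caratheodory_bigU => i; exact: caratheodoryC.
Qed.

Lemma caratheodory_halfplane v (a : R) : cara [set x | (dot x v <= a)%R].
Proof.
rewrite (_ : [set x | _] = [set x | (dot x v - a <= 0)%R]); last first.
  by apply/seteqP; split=> x; rewrite /= subr_le0.
apply: (caratheodory_lipschitz_le0 (L := (enorm v + 1)%R)).
  by rewrite ltr_pwDr// enorm_ge0.
move=> x y; rewrite opprB addrA subrK -dotBl (le_trans (dot_le_enorm _ _))//.
by rewrite mulrC ler_wpM2r ?enorm_ge0// lerDl.
Qed.

Lemma caratheodory_circle y : cara [set x | enorm (x - y)%R = 1%R].
Proof.
have -> : [set x | enorm (x - y)%R = 1%R] = [set x | (enorm (x - y) - 1 <= 0)%R] `&`
    [set x | (1 - enorm (x - y) <= 0)%R].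
  apply/seteqP; split=> x /=; first by move=> ->; rewrite subrr.
  by rewrite !subr_le0 => -[? ?]; apply/eqP; rewrite eq_le; apply/andP.
have lip x z : (enorm (x - y) - enorm (z - y) <= enorm (x - z))%R.
  by rewrite lerBlDr enorm_tri.
apply: caratheodoryI; apply: (caratheodory_lipschitz_le0 ltr01) => x z; rewrite mul1r.
  by have := lip x z; lra.
by have := lip z x; rewrite (enormB z x); lra.
Qed.

(** Two closed half planes cut out the line, two open ones cut off its ends. *)
Lemma caratheodory_open_segment p q : p != q -> cara (open_segment p q).
Proof.
move=> pq; set w := (q - p)%R.
have w0 : w != 0%R by rewrite subr_eq0 eq_sym.
have ww : (0 < dot w w)%R.
  by rewrite lt_def dot_ge0 andbT; apply: contra w0 => /eqP/dot_eq0 ->.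
have -> : open_segment p q = [set x | (dot x (perp w) <= dot p (perp w))%R] `&`
    [set x | (dot x (- perp w) <= dot p (- perp w))%R] `&`
    (~` [set x | (dot x w <= dot p w)%R] `&`
     ~` [set x | (dot x (- w) <= dot q (- w))%R]).
  have qE : (dot q w = dot p w + dot w w)%R by rewrite -dotDl addrC subrK.
  apply/seteqP; split=> [_ [t + <-]|x [[/= x1 x2] [/= x3 x4]]].
    rewrite /= in_itv/= => /andP[t0 t1].
    rewrite -/w !dotNr !dotDl !dotZl dot_perpr mulr0 addr0 qE.
    by split; split=> //; apply/negP; rewrite -ltNge; nra.
  move: x1 x2 x3 x4; rewrite !dotNr !lerN2 qE => x1 x2 /negP + /negP.
  rewrite -!ltNge => x3 x4; exists ((dot x w - dot p w) / dot w w)%R.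
    have h : (0 < dot x w - dot p w)%R by rewrite subr_gt0.
    by rewrite /= in_itv/= divr_gt0//= ltr_pdivrMr// mul1r ltrBlDl.
  rewrite -/w; apply: (dot_perp_inj w0).
    by rewrite dotDl dotZl divfK ?gt_eqF// addrC subrK.
  rewrite dotDl dotZl dot_perpr mulr0 addr0.
  by apply/eqP; rewrite eq_le x1 x2.
do 2?apply: caratheodoryI; do ?apply: caratheodoryC; exact: caratheodory_halfplane.
Qed.

Lemma hausdorff1_bigU_null (I : Type) (s : seq I) (F : I -> set 'rV[R]_2) :
  (forall i, hausdorff1 (F i) = 0) -> hausdorff1 (\big[setU/set0]_(i <- s) F i) = 0.
Proof.
move=> F0; elim: s => [|i s IH]; first by rewrite big_nil hausdorff1_set0.
apply/eqP; rewrite eq_le hausdorff1_ge0 andbT big_cons.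
by rewrite (le_trans (hausdorff1U _ _))// IH F0 adde0.
Qed.

(** Null overlaps must be allowed, since arcs translated to the origin share edge normals. Splitting
    along the measurable set [F i] removes from the rest of the union only a null part. *)
Lemma hausdorff1_null_bigU (I : finType) (D : {set I}) (F : I -> set 'rV[R]_2) :
  (forall i, i \in D -> cara (F i)) ->
  (forall i j, i \in D -> j \in D -> i != j -> hausdorff1 (F i `&` F j) = 0) ->
  hausdorff1 (\bigcup_(i in [set` D]) F i) = \sum_(i in D) hausdorff1 (F i).
Proof.
move=> cF F0.
have -> : [set` D] = [set` enum D] by apply/seteqP; split=> i /=; rewrite mem_enum.
rewrite bigcup_seq -big_enum/=.
have : {subset enum D <= D} by move=> i; rewrite mem_enum.
elim: (enum D) (enum_uniq D) => [|i s IH]; first by rewrite !big_nil hausdorff1_set0.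
rewrite cons_uniq => /andP[iS us] sD.
have iD : i \in D by apply: sD; rewrite mem_head.
have sD' : {subset s <= D} by move=> j js; apply: sD; rewrite inE js orbT.
rewrite !big_cons -IH//; set U := \big[setU/set0]_(_ <- _) _.
have UFi : hausdorff1 (U `&` F i) = 0.
  apply/eqP; rewrite eq_le hausdorff1_ge0 andbT.
  rewrite -(@hausdorff1_bigU_null _ s
    (fun j => if j \in s then F j `&` F i else set0)).
    apply: le_hausdorff1; rewrite /U -!bigcup_seq => x [[j js Fjx] Fix].
    by exists j => //=; rewrite ifT.
  move=> j; case: ifPn => [js|_]; last exact: hausdorff1_set0.
  apply: F0 => //; first exact: sD'.
  by apply: contraNneq iS => <-.
have Fcara := cF _ iD.
rewrite [LHS]Fcara; congr (_ + _).
  by rewrite (setIidr (@subsetUl _ (F i) U)).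
rewrite setIUl setICr set0U.
apply/eqP; rewrite eq_le; apply/andP; split; first by apply: le_hausdorff1 => x [].
by rewrite [leLHS]Fcara UFi add0e.
Qed.

End caratheodory_plane.

Section perimeter.
Variables (R : realType) (n : nat) (c : config R n).
Hypothesis row_inj : injective (fun i => row i c).
Implicit Types (u v x y z : 'rV[R]_2) (i p q : 'I_n) (pq : 'I_n * 'I_n).

Let P := centre_hull c.

Lemma hull_edge_vertices p q : (p, q) \in hull_edges c ->
  [/\ p \in hull_vertices c, q \in hull_vertices c & p != q].
Proof. by move=> /hull_edgeP[]. Qed.

Lemma vertex_off_side i p q : i \in hull_vertices c -> p != q ->
  ~ open_segment (row p c) (row q c) (row i c).
Proof.
move=> iv pq /(extreme_open_segment iv (row_centre_hull c p) (row_centre_hull c q)).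
by move=> /row_inj/eqP; rewrite (negbTE pq).
Qed.

Lemma open_segment_dir u v (s L : R) : 0 < s -> s < L ->
  open_segment u (u + L *: v) (u + s *: v).
Proof.
move=> s0 sL; have L0 := lt_trans s0 sL.
exists (s / L); first by rewrite /= in_itv/= divr_gt0//= ltr_pdivrMr// mul1r.
by rewrite addrAC subrr add0r scalerA divfK// gt_eqF.
Qed.

(** Two edges with the same direction and a common inner point lie on one line; were their starts or
    their ends different, a vertex would lie inside an edge. *)
Lemma hull_edge_eq p q p' q' y :
  (p, q) \in hull_edges c -> (p', q') \in hull_edges c ->
  udir c p q = udir c p' q' ->
  open_segment (row p c) (row q c) y -> open_segment (row p' c) (row q' c) y ->
  (p, q) = (p', q').
Proof.
move=> /hull_edge_vertices[pv qv pq] /hull_edge_vertices[pv' qv' pq'].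
set u := udir c p q => u'.
set L := enorm (row q c - row p c); set L' := enorm (row q' c - row p' c).
have qE : row q c = row p c + L *: u.
  by rewrite -enorm_normalizeE addrC subrK.
have qE' : row q' c = row p' c + L' *: u.
  by rewrite u' -enorm_normalizeE addrC subrK.
have L0 : 0 < L.
  by rewrite enorm_gt0 subr_eq0; apply: contra pq => /eqP/row_inj ->.
have L0' : 0 < L'.
  by rewrite enorm_gt0 subr_eq0; apply: contra pq' => /eqP/row_inj ->.
move=> [t + yE] [t' + yE']; rewrite /= !in_itv/= => /andP[t0 t1] /andP[t0' t1'].
have pp' : row p' c = row p c + (t * L - t' * L') *: u.
  rewrite scalerBl -!scalerA addrA; apply/eqP; rewrite eq_sym subr_eq; apply/eqP.
  by move: yE; rewrite -yE' qE qE' ![_ + _ *: _ - _]addrAC !subrr !add0r.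
(* [t * L - t' * L'] is the signed distance from p to p' along [u]; its sign decides which start
   lies inside the other edge. *)
have ep : p = p'.
  have [h|h|h] := ltgtP (t * L - t' * L') 0.
  - have : open_segment (row p' c) (row q' c) (row p c).
      have -> : row p c = row p' c + (t' * L' - t * L) *: u.
        by rewrite pp' -addrA -scalerDl addrA subrK subrr scale0r addr0.
      by rewrite qE'; apply: open_segment_dir; nra.
    by move/(vertex_off_side pv pq').
  - have : open_segment (row p c) (row q c) (row p' c).
      by rewrite pp' qE; apply: open_segment_dir; nra.
    by move/(vertex_off_side pv' pq).
  - by apply: row_inj; rewrite pp' h scale0r addr0.
subst p'; congr (_, _).
have [h|h|h] := ltgtP L L'.
- have : open_segment (row p c) (row q' c) (row q c).
    by rewrite qE qE'; exact: open_segment_dir.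
  by move/(vertex_off_side qv pq').
- have : open_segment (row p c) (row q c) (row q' c).
    by rewrite qE qE'; exact: open_segment_dir.
  by move/(vertex_off_side qv' pq).
- by apply: row_inj; rewrite qE qE' h.
Qed.

Lemma hull_side_foot p q x : (p, q) \in hull_edges c -> hull_side c (p, q) x ->
  exists y, [/\ open_segment (row p c) (row q c) y, P y,
    normal_cone c y (edge_normal c p q) & x = y + edge_normal c p q].
Proof.
move=> pq /hull_sideP[y ypq xE]; exists y; split=> //.
  by apply: open_segment_hull ypq; exact: row_centre_hull.
by case: ypq => t _ <-; exact: hull_edge_normal pq (erefl _).
Qed.

Lemma hull_side_disjoint pq pq' : pq \in hull_edges c -> pq' \in hull_edges c ->
  pq != pq' -> hull_side c pq `&` hull_side c pq' = set0.
Proof.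
case: pq pq' => [p q] [p' q'] e e' ne; apply/seteqP; split=> // x [].
move=> /(hull_side_foot e)[y [ypq Py yn ->]].
move=> /(hull_side_foot e')[y' [ypq' Py' yn' E]].
have yy' := nearest_point_uniq Py Py' yn yn' E; subst y'.
move: ne; apply/negP; rewrite negbK; apply/eqP; apply: hull_edge_eq ypq ypq' => //.
have /oppr_inj h := addrI _ E; rewrite -[LHS]opprK -[RHS]opprK.
have rr v : - v = perp (perp v) :> 'rV[R]_2 by apply: rV2P; rewrite !mxE.
by rewrite !rr h.
Qed.

Lemma hull_arc_disjoint i j : i != j -> hull_arc c i `&` hull_arc c j = set0.
Proof.
move=> ij; apply/seteqP; split=> // x [[_ xi] [_ xj]].
have := nearest_point_uniq (row_centre_hull c i) (row_centre_hull c j) xi xj.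
by rewrite !(addrC (row _ _)) !subrK => /(_ erefl)/row_inj/eqP; rewrite (negbTE ij).
Qed.

Lemma hull_arc_side_disjoint i pq : i \in hull_vertices c -> pq \in hull_edges c ->
  hull_arc c i `&` hull_side c pq = set0.
Proof.
case: pq => p q iv e; apply/seteqP.
split=> // x [[_ xi] /(hull_side_foot e)[y [ypq Py yn E]]].
have := nearest_point_uniq (row_centre_hull c i) Py xi yn.
rewrite addrC subrK => /(_ E) iy; have [_ _ pq] := hull_edge_vertices e.
by apply: (vertex_off_side iv pq); rewrite iy.
Qed.

(** With [a = row i c] this is [hull_arc], with [a = 0] its translate to the origin; one
    measurability proof serves both. *)
Definition normal_arc i a : set 'rV[R]_2 :=
  [set x | enorm (x - a) = 1 /\ normal_cone c (row i c) (x - a)].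

Lemma caratheodory_normal_arc i a : (@hausdorff1 R).-caratheodory (normal_arc i a).
Proof.
have -> : normal_arc i a = [set x | enorm (x - a) = 1] `&`
    [set x | forall k, dot x (row k c - row i c) <= dot a (row k c - row i c)].
  apply/seteqP; split=> x [xa xi]; split=> //.
    by move=> k; rewrite -subr_le0 -dotBl dotC; apply: xi; exact: row_centre_hull.
  move=> z Pz; rewrite dotBl subr_le0; apply: centre_hull_halfplane Pz => k.
  by rewrite -subr_le0 -dotBl dotC dotBl subr_le0; exact: xi.
apply: caratheodoryI; first exact: caratheodory_circle.
by apply: caratheodory_forall => k; exact: caratheodory_halfplane.
Qed.

(** A direction normal at two vertices is normal at their midpoint, which is not a vertex, so
    [hull_face] makes it one of the finitely many edge normals. *)
Lemma normal_arc_overlap i j : (0 < n)%N -> i != j ->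
  hausdorff1 (normal_arc i 0 `&` normal_arc j 0) = 0%E.
Proof.
move=> n0 ij; apply/eqP; rewrite eq_le hausdorff1_ge0 andbT.
pose F pq : set 'rV[R]_2 := [set edge_normal c pq.1 pq.2].
rewrite -(@hausdorff1_bigU_null _ _ (enum (hull_edges c)) F); last first.
  by move=> pq; exact: hausdorff1_set1.
apply: le_hausdorff1; rewrite -bigcup_seq => u [].
rewrite /normal_arc /= !subr0 => -[u1 ui] [_ uj].
pose y := row i c + 2^-1 *: (row j c - row i c).
have yij : open_segment (row i c) (row j c) y.
  by exists 2^-1 => //=; rewrite in_itv/= invr_gt0 ltr0n/= invf_lt1// ltr1n.
have Py : P y := open_segment_hull (row_centre_hull c i) (row_centre_hull c j) yij.
have yu : normal_cone c y u.
  move=> z Pz; have := ui z Pz; have := uj z Pz.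
  by rewrite /y !dotBl dotDl dotZl dotBl; lra.
have [[k kv yk]|[p [q [pq uE _]]]] := hull_face n0 Py u1 yu.
  by case: (vertex_off_side kv ij); rewrite -yk.
by exists (p, q) => //=; rewrite mem_enum.
Qed.

Lemma sum_hull_arcs : (0 < n)%N ->
  (\sum_(i in hull_vertices c) hausdorff1 (hull_arc c i) =
   hausdorff1 (@unit_circle R))%E.
Proof.
move=> n0; transitivity (\sum_(i in hull_vertices c) hausdorff1 (normal_arc i 0))%E.
  apply: eq_bigr => i _; rewrite -(hausdorff1_translate (row i c) (normal_arc i 0)).
  congr hausdorff1; apply/seteqP; split=> [x [x1 xi]|_ [x + <-]].
    exists (x - row i c); last by rewrite addrC subrK.
    by rewrite /normal_arc /= subr0.
  by rewrite /normal_arc /hull_arc /= subr0 addrAC subrr add0r.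
rewrite -hausdorff1_null_bigU; first last.
- by move=> i j _ _ ij; exact: normal_arc_overlap.
- by move=> i _; exact: caratheodory_normal_arc.
congr hausdorff1; apply/seteqP; split=> [x [i _ []]|x x1].
  by rewrite subr0.
have [i iv ix] := circle_normal_cone c n0 x1.
by exists i => //; rewrite /normal_arc /= subr0.
Qed.

Lemma PerE : (0 < n)%N -> Per c =
  ((\sum_(pq in hull_edges c) dist c pq.1 pq.2)%:E + hausdorff1 (@unit_circle R))%E.
Proof.
move=> n0; rewrite /Per -/(disk_hull c) boundary_arcs_sides//.
set A := \bigcup_(i in _) _; set S := \bigcup_(pq in _) _.
have AS : A `&` S = set0.
  apply/seteqP; split=> // x [[i iv ix] [pq e xe]].
  by have <- : hull_arc c i `&` hull_side c pq = set0 by exact: hull_arc_side_disjoint.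
have Acara : (@hausdorff1 R).-caratheodory A.
  have -> : A = \big[setU/set0]_(i <- enum (hull_vertices c)) hull_arc c i.
    rewrite -bigcup_seq; congr bigcup; apply/seteqP.
    by split=> i /=; rewrite mem_enum.
  by apply: caratheodory_bigU => i; exact: caratheodory_normal_arc.
rewrite [LHS]Acara (setIidr (@subsetUl _ A S)) setIUl setICr set0U.
have -> : S `&` ~` A = S.
  by apply/setIidl => x Sx Ax; have : set0 x by rewrite -AS.
rewrite [LHS]addeC -sum_hull_arcs//.
congr (_ + _)%E; last first.
  apply: hausdorff1_null_bigU => [i _|i j _ _ ij].
    exact: caratheodory_normal_arc.
  by rewrite hull_arc_disjoint// hausdorff1_set0.
have sideN pq : pq \in hull_edges c ->
    row pq.1 c + edge_normal c pq.1 pq.2 != row pq.2 c + edge_normal c pq.1 pq.2.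
  case: pq => p q /hull_edge_vertices[_ _ pq] /=.
  by apply: contra pq => /eqP/addIr/row_inj ->.
rewrite [LHS]hausdorff1_null_bigU.
- rewrite -sumEFin; apply: eq_bigr => pq /sideN ne.
  rewrite hausdorff1_open_segment//; congr (enorm _)%:E.
  by rewrite opprD addrACA subrr addr0.
- by move=> pq /sideN; exact: caratheodory_open_segment.
- by move=> pq pq' e e' ne; rewrite hull_side_disjoint// hausdorff1_set0.
Qed.

End perimeter.

(** * Differentiating the perimeter *)

Section dist_differential.
Variables (R : realType) (n : nat).
Implicit Types (c d eta : config R n) (p q i j : 'I_n).

Lemma is_diff_coord c i k :
  is_diff c (fun d : config R n => d i k : R) (fun d => d i k).
Proof.
pose f d : R := d i k.
have f_lin : linear f by move=> a d d'; rewrite /f !mxE.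
pose fM := GRing.isLinear.Build _ _ _ _ f f_lin.
pose fL : {linear config R n -> R} := HB.pack f fM.
apply: DiffDef; first exact: differentiable_coord.
by rewrite (@diff_lin _ _ _ fL)//; exact: coord_continuous.
Qed.

Lemma is_diff_dist c p q : row p c != row q c ->
  is_diff c (fun d => dist d p q)
    (fun eta => dot (udir c p q) (row q eta - row p eta)).
Proof.
move=> pq; pose l k d : R := d q k - d p k.
have dl k : is_diff c (l k) (l k).
  exact: is_diffB (is_diff_coord c q k) (is_diff_coord c p k).
have dh := is_diffD (is_diffM (dl 0) (dl 0)) (is_diffM (dl 1) (dl 1)).
(* The squared distance, a polynomial in the coordinates; distinct centres make it positive, where
   the square root is differentiable. *)
set h := (l 0 * l 0 + l 1 * l 1) in dh.
have hE d : h d = dot (row q d - row p d) (row q d - row p d).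
  by rewrite dotE !mxE.
have h0 : 0 < h c.
  by rewrite hE -sqr_enorm exprn_gt0// enorm_gt0 subr_eq0 eq_sym.
have ds : is_derive (h c) 1 Num.sqrt (2 * Num.sqrt (h c))^-1 := is_derive1_sqrt h0.
have dsd : differentiable Num.sqrt (h c) by apply/derivable1_diffP; case: ds.
have distE : (fun d => dist d p q) = Num.sqrt \o h.
  by apply/funext => d /=; rewrite hE.
have [hdiff dhE] := dh.
rewrite distE; apply: DiffDef; first exact: differentiable_comp.
apply/funext => eta; rewrite diff_comp//= (diff1E dsd) derive1E derive_val.
rewrite dhE /udir /normalize dotZl.
have -> : enorm (row q c - row p c) = Num.sqrt (h c) by rewrite hE.
have s0 : Num.sqrt (h c) != 0 by rewrite gt_eqF// sqrtr_gt0.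
rewrite dotE !mxE; have lE k d : l k d = d q k - d p k by [].
rewrite -[(_ + _) eta]/(l 0 c * l 0 eta + l 0 c * l 0 eta +
  (l 1 c * l 1 eta + l 1 c * l 1 eta)) !lE.
by rewrite -[_ *: _]/(_ * _); field.
Qed.

End dist_differential.

Section one_variable.
Variable R : realType.

Lemma is_diff_sum_seq (V W : normedModType R) (I : eqType) (s : seq I)
    (f df : I -> V -> W) (x : V) :
  (forall i, i \in s -> is_diff x (f i) (df i)) ->
  is_diff x (fun y => \sum_(i <- s) f i y) (fun y => \sum_(i <- s) df i y).
Proof.
elim: s => [|i s IH] fdf.
  under [X in is_diff _ X _]eq_fun do rewrite big_nil.
  under [X in is_diff _ _ X]eq_fun do rewrite big_nil.
  exact: is_diff_cst.
under [X in is_diff _ X _]eq_fun do rewrite big_cons.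
under [X in is_diff _ _ X]eq_fun do rewrite big_cons.
apply: is_diffD; first by apply: fdf; rewrite mem_head.
by apply: IH => j js; apply: fdf; rewrite inE js orbT.
Qed.

Lemma derive1_local_min (f : R -> R) (x : R) : derivable f x 1 ->
  (\forall t \near x, f x <= f t) -> 'D_1 f x = 0.
Proof.
move=> df [e1 /= e10 near1].
apply/eqP/negP => /negP D0.
have : \forall h \near 0^', 0 < h^-1 * (f (h + x) - f x) * 'D_1 f x.
  have dfx : h^-1 * (f (h + x) - f x) @[h --> 0^'] --> 'D_1 f x.
    rewrite (_ : (fun h => _) = (fun h => h^-1 *: (f (h *: 1 + x) - f x))).
      exact: df.
    by apply/funext => h; rewrite [h *: 1]mulr1.
  have hD : h^-1 * (f (h + x) - f x) * 'D_1 f x @[h --> 0^'] -->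
      'D_1 f x * 'D_1 f x.
    exact: cvgM dfx (cvg_cst _).
  have D2 : 0 < 'D_1 f x * 'D_1 f x by rewrite -expr2 exprn_even_gt0.
  exact: (cvgr_gt _ hD _ D2).
move=> [e2 /= e20 near2].
pose h := Num.min e1 e2 / 2.
have h0 : 0 < h by rewrite divr_gt0// lt_min e10.
have he : h < Num.min e1 e2 by rewrite ltr_pdivrMr// ltr_pMr ?ltr1n// lt_min e10.
move: he; rewrite lt_min => /andP[he1 he2].
have key t : `|t| = h ->
    0 <= f (t + x) - f x /\ 0 < t^-1 * (f (t + x) - f x) * 'D_1 f x.
  move=> th; split.
    rewrite subr_ge0; apply: near1.
    by rewrite /ball/= opprD addrCA subrr addr0 normrN th.
  apply: near2; first by rewrite /ball/= sub0r normrN th.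
  by rewrite -normr_gt0 th.
(* Near 0 the difference quotient has the sign of the derivative. A step to the right if the
   derivative is negative, to the left if positive, makes minimality give the opposite sign. *)
have [D1|D1|D1] := ltgtP ('D_1 f x) 0; last by rewrite D1 eqxx in D0.
- have [p1 p2] := key h (gtr0_norm h0).
  have : 0 <= h^-1 * (f (h + x) - f x) by rewrite mulr_ge0// invr_ge0 ltW.
  by nra.
- have [p1 p2] := key (- h) (etrans (normrN _) (gtr0_norm h0)).
  have : (- h)^-1 * (f (- h + x) - f x) <= 0.
    by rewrite mulr_le0_ge0// invr_le0 oppr_le0 ltW.
  by nra.
Qed.

End one_variable.

(** * One edge in and one edge out at each vertex *)

Section hull_edges_at_vertex.
Variables (R : realType) (n : nat) (c : config R n).
Hypothesis row_inj : injective (fun i => row i c).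
Implicit Types (i p q : 'I_n).

(** Of three distinct points on a line one lies between the other two, so it is not extreme. *)
Lemma collinear_vertices i p q : i \in hull_vertices c ->
  p \in hull_vertices c -> q \in hull_vertices c -> p != i -> q != i ->
  det2 (row p c - row i c) (row q c - row i c) = 0 -> p = q.
Proof.
move=> iv pv qv pi qi; set w := row p c - row i c; set w' := row q c - row i c => d0.
have [//|pq] := eqVneq p q; exfalso.
have w0 : w != 0 by rewrite subr_eq0; apply: contra pi => /eqP/row_inj ->.
have ww : dot w w != 0 by apply: contra w0 => /eqP/dot_eq0 ->.
pose l := dot w' w / dot w w.
have w'E : w' = l *: w.
  apply: (dot_perp_inj w0); first by rewrite dotZl divfK.
  by rewrite dotZl dot_perpr mulr0 dotC dot_perpl.
(* On the line through i and p, parametrised by 0 at i and 1 at p, the point q has parameter [l];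
   the position of [l] tells which point is in the middle. *)
have pE : row p c = row i c + 1 *: w by rewrite scale1r addrC subrK.
have qE : row q c = row i c + l *: w by rewrite -w'E addrC subrK.
have iE : row i c = row q c + (- l) *: w by rewrite qE scaleNr addrK.
have pE' : row p c = row q c + (1 - l) *: w.
  by rewrite pE qE -addrA -scalerDl addrCA subrr addr0.
have [l0|l0|l0] := ltgtP l 0; last first.
- have /row_inj qi0 : row q c = row i c by rewrite qE l0 scale0r addr0.
  by move: qi; rewrite qi0 eqxx.
- have [l1|l1|l1] := ltgtP l 1.
  + have /(vertex_off_side row_inj qv) : i != p by rewrite eq_sym.
    by apply; rewrite pE qE; exact: open_segment_dir.
  + have /(vertex_off_side row_inj pv) : i != q by rewrite eq_sym.
    by apply; rewrite pE qE; exact: open_segment_dir.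
  + have /row_inj qp0 : row q c = row p c by rewrite qE l1 -pE.
    by move: pq; rewrite qp0 eqxx.
- have /(vertex_off_side row_inj iv) : q != p by rewrite eq_sym.
  by apply; rewrite iE pE'; apply: open_segment_dir; lra.
Qed.

Lemma hull_edge_det p q x : (p, q) \in hull_edges c -> centre_hull c x ->
  0 <= det2 (row q c - row p c) (x - row p c).
Proof. by move=> /hull_edgeP[_ _ _]; apply. Qed.

(** Each end lies to the left of the edge to the other, so the antisymmetric determinant of the two
    edge vectors has both signs and vanishes. *)
Lemma hull_edge_out i q q' : (i, q) \in hull_edges c -> (i, q') \in hull_edges c ->
  q = q'.
Proof.
move=> e e'; have [iv qv iq] := hull_edge_vertices e.
have [_ qv' iq'] := hull_edge_vertices e'.
apply: (collinear_vertices iv qv qv'); rewrite 1?eq_sym//.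
have := hull_edge_det e (row_centre_hull c q').
have := hull_edge_det e' (row_centre_hull c q).
by rewrite /det2 => h h'; lra.
Qed.

Lemma hull_edge_in i p p' : (p, i) \in hull_edges c -> (p', i) \in hull_edges c ->
  p = p'.
Proof.
move=> e e'; have [pv iv pi] := hull_edge_vertices e.
have [pv' _ pi'] := hull_edge_vertices e'.
apply: (collinear_vertices iv pv pv') => //.
have := hull_edge_det e (row_centre_hull c p').
have := hull_edge_det e' (row_centre_hull c p).
by rewrite /det2 !mxE => h h'; lra.
Qed.

End hull_edges_at_vertex.

Lemma packings_row_inj (R : realType) n (c : config R n) :
  packings c -> injective (fun i => row i c).
Proof.
move=> pc i j ij; apply/eqP/negPn/negP => /pc.
by rewrite /dist ij subrr enorm0 leNgt ltr0n.
Qed.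

Section single_row_motion.
Variables (R : realType) (n : nat).
Implicit Types (c eta : config R n) (i j k p q : 'I_n) (w : 'rV[R]_2).

Definition move_row i w : config R n := delta_mx i 0 *m w.

Lemma row_move_row k i w : row k (move_row i w) = (k == i)%:R *: w.
Proof.
apply/rowP => l; rewrite !mxE big_ord1 !mxE andbT.
by [].
Qed.

Lemma is_diff_Per_tilde c0 c : injective (fun i => row i c) ->
  hull_edges c = hull_edges c0 ->
  is_diff c (Per_tilde c0) (fun eta => \sum_(pq in hull_edges c)
    dot (udir c pq.1 pq.2) (row pq.2 eta - row pq.1 eta)).
Proof.
move=> row_inj; rewrite /Per_tilde => <-.
have dS : is_diff c
   (fun d : config R n => \sum_(pq <- enum (hull_edges c)) dist d pq.1 pq.2)
   (fun eta => \sum_(pq <- enum (hull_edges c))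
    dot (udir c pq.1 pq.2) (row pq.2 eta - row pq.1 eta)).
  apply: is_diff_sum_seq => -[p q]; rewrite mem_enum => /hull_edge_vertices[_ _ pq] /=.
  by apply: is_diff_dist; apply: contra pq => /eqP/row_inj ->.
have := is_diffD dS (is_diff_cst (2 * pi) c); rewrite addr0.
congr (is_diff c _ _); apply/funext => d; first congr (_ + _).
  by rewrite big_enum.
by rewrite big_enum.
Qed.

(** The sum is split into contributions of heads and of tails before the single surviving term of
    each is selected, so a segment hull, where [p = q], is covered too. *)
Lemma sum_edges_move_row c i p q w : injective (fun i => row i c) ->
  (p, i) \in hull_edges c -> (i, q) \in hull_edges c ->
  \sum_(pq in hull_edges c)
    dot (udir c pq.1 pq.2) (row pq.2 (move_row i w) - row pq.1 (move_row i w)) =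
  dot (udir c p i - udir c i q) w.
Proof.
move=> row_inj pi iq.
under eq_bigr do rewrite dotBr !row_move_row !dotZr.
rewrite sumrB dotBl; congr (_ - _).
  rewrite (bigD1 (p, i))//= eqxx mul1r big1 ?addr0// => -[a b] /= /andP[e ne].
  case: eqP => [bi|]; last by rewrite mul0r.
  by move: ne; rewrite bi in e *; rewrite (hull_edge_in row_inj e pi) eqxx.
rewrite (bigD1 (i, q))//= eqxx mul1r big1 ?addr0// => -[a b] /= /andP[e ne].
case: eqP => [ai|]; last by rewrite mul0r.
by move: ne; rewrite ai in e *; rewrite (hull_edge_out row_inj e iq) eqxx.
Qed.

End single_row_motion.

(** * Rolling the leaf about its neighbour *)

Section rotation.
Variables (R : realType) (n : nat) (c : config R n) (i j : 'I_n).
Hypothesis ij : i != j.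

Let a := row i c - row j c.

(** Turns centre i about centre j through the angle [s]. In this additive form, with fixed matrices
    and scalar coefficients, the differential at 0 can be read off. *)
Definition roll_row (s : R) : config R n :=
  c + ((cos s - 1) *: move_row i a + sin s *: move_row i (perp a)).

Lemma roll_row0 : roll_row 0 = c.
Proof. by rewrite /roll_row cos0 sin0 subrr !scale0r !addr0. Qed.

Lemma row_roll_row k s : row k (roll_row s) =
  if k == i then row j c + (cos s *: a + sin s *: perp a) else row k c.
Proof.
rewrite /roll_row !linearD/= !linearZ/= !row_move_row.
case: eqP => [->|_]; last first.
  by rewrite !scale0r !scaler0 !addr0.
by rewrite !scale1r; apply: rV2P; rewrite !mxE/=; ring.
Qed.

Lemma dist_roll_row k s : k != i -> dist (roll_row s) k i =
  enorm (row j c - row k c + (cos s *: a + sin s *: perp a)).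
Proof.
move=> ki; rewrite /dist !row_roll_row eqxx (negbTE ki).
by rewrite addrAC.
Qed.

Lemma dist_sym (d : config R n) k l : dist d k l = dist d l k.
Proof. by rewrite /dist enormB. Qed.

Lemma dist_roll_row_pivot s : dist (roll_row s) i j = dist c i j.
Proof.
rewrite dist_sym dist_roll_row 1?eq_sym// subrr add0r dist_sym.
apply/enorm_eqP; first exact: enorm_ge0.
rewrite sqr_enorm -/a -[RHS]mul1r -(cos2Dsin2 s).
by rewrite !dotE !mxE/=; ring.
Qed.

Lemma dist_roll_row_fixed k l s : k != i -> l != i ->
  dist (roll_row s) k l = dist c k l.
Proof. by move=> ki li; rewrite /dist !row_roll_row (negbTE ki) (negbTE li). Qed.

Lemma is_diff_roll_row : is_diff (0 : R) roll_row (fun s => s *: move_row i (perp a)).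
Proof.
have dsin : is_diff (0 : R) (@sin R) id.
  have ds : is_derive (0 : R) 1 (@sin R) (cos 0) := is_derive_sin 0.
  have sdiff : differentiable (@sin R) 0 by apply/derivable1_diffP; case: ds.
  apply: DiffDef => //; apply/funext => s.
  by rewrite (diff1E sdiff) derive1E derive_val cos0 [_ *: _]mulr1.
have dcos : is_diff (0 : R) (@cos R) (fun=> 0).
  have dc : is_derive (0 : R) 1 (@cos R) (- sin 0) := is_derive_cos 0.
  have cdiff : differentiable (@cos R) 0 by apply/derivable1_diffP; case: dc.
  apply: DiffDef => //; apply/funext => s.
  by rewrite (diff1E cdiff) derive1E derive_val sin0 oppr0 scaler0.
pose A := move_row i a; pose B := move_row i (perp a).
have dA := is_diff_comp (is_diffB dcos (is_diff_cst (1 : R) (0 : R)))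
  (is_diff_scalel _ A).
have dB := is_diff_comp dsin (is_diff_scalel _ B).
have := is_diffD (is_diff_cst c (0 : R)) (is_diffD dA dB).
congr (is_diff _ _ _); apply/funext => s.
rewrite -[LHS]/(0 + ((0 - 0) *: A + s *: B)).
by rewrite subrr scale0r !add0r.
Qed.

End rotation.

Theorem theorem4p2 (R : realType) (n : nat)
    (e : rel 'I_n) (e_sym : symmetric e) (e_irr : irreflexive e)
    (c0 : config R n) (hc0 : class_base e c0)
    (c : config R n) (hcX : fixed_class e c0 c)
    (hc : rel_interior_regular e c0 c)
    (i j : 'I_n) (hi : hull_leaf e c i) (hij : e i j)
    (p q : 'I_n) (hpi : (p, i) \in hull_edges c0)
    (hiq : (i, q) \in hull_edges c0)
    (t_in := udir c p i) (t_out := udir c i q) (g := t_in - t_out) :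
  (class_critical e c0 c -> g \in <[udir c i j]>%VS) /\
  (g \notin <[udir c i j]>%VS ->
     ~ class_critical e c0 c /\
     ~ local_minimiser (@Per R n) (fixed_class e c0) c).
Proof.
have n0 : (0 < n)%N := leq_ltn_trans (leq0n i) (ltn_ord i).
have [[pc [_ hullE]] cc] := hcX.
have row_inj := packings_row_inj pc.
have ij : i != j by apply/eqP => ij; move: hij; rewrite ij e_irr.
have dij : dist c i j = 2 by have := cc.2 i j ij; rewrite hij.
have leafj k : e i k -> k = j.
  case: hi => _ /eqP/cards1P[l hl] eik.
  have : k \in [set k | e i k]%SET by rewrite inE.
  have : j \in [set k | e i k]%SET by rewrite inE.
  by rewrite hl !inE => /eqP -> /eqP ->.
have [Pdiff PdE] := is_diff_Per_tilde row_inj hullE.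
have dPer w : 'd (Per_tilde c0) c (move_row i w) = dot g w.
  by rewrite PdE (@sum_edges_move_row _ _ c i p q)// hullE.
set u := udir c i j.
have u1 : enorm u = 1.
  by rewrite enorm_normalize// -enorm_gt0 [enorm _]dij.
have parallel : dot g (perp u) = 0 -> g \in <[u]>%VS.
  move=> h; apply/vlineP; exists (dot u g).
  by rewrite {1}(orthobasis g u1) (dotC (perp u)) h scale0r addr0.
have critical : class_critical e c0 c -> g \in <[u]>%VS.
  (* The test motion moves only centre i, with velocity [perp u]. Every contact constraint that
     involves i is the one with j, possibly in reverse order, and it holds as [perp u] is orthogonal
     to [u]. *)
  move=> crit; apply: parallel; rewrite -dPer; apply: crit => k l ekl.
  rewrite !row_move_row.
  have kl : k != l by apply/eqP => kl; move: ekl; rewrite kl e_irr.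
  have [ki|ki] := eqVneq k i.
    have -> : l = j by apply: leafj; rewrite -ki.
    by rewrite ki eq_sym (negbTE ij) scale0r scale1r sub0r dotNr dot_perpr oppr0.
  have [li|li] := eqVneq l i; last by rewrite !scale0r subrr dot0r.
  have -> : k = j by apply: leafj; rewrite -li e_sym.
  rewrite li scale0r scale1r subr0.
  have -> : udir c j i = - u.
    by rewrite /u /udir /normalize -scalerN opprB enormB.
  by rewrite dotC dotNr dotC dot_perpr oppr0.
split=> // gu; split; first by move/critical; apply/negP.
(* Minimality is tested along a single curve inside the class, so no multiplier rule is needed. *)
move=> [_ cmin]; move/negP: gu; apply; apply: parallel.
pose a := row i c - row j c; pose gam := roll_row c i j.
have gam0 : gam 0 = c by exact: roll_row0.
have [gdiff gdE] := is_diff_roll_row c i j.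
have gc : {for 0, continuous gam} by exact: differentiable_continuous.
have near_gam (A : set (config R n)) : nbhs c A ->
    \forall s \near (0 : R), A (gam s).
  by move=> Ac; apply: gc; rewrite gam0.
have gamM s : contact_variety e (gam s).
  move=> k l ekl.
  have kl : k != l by apply/eqP => kl; move: ekl; rewrite kl e_irr.
  have distc : dist c k l = 2 by have := cc.2 k l kl; rewrite ekl.
  have [ki|ki] := eqVneq k i.
    have -> : l = j by apply: leafj; rewrite -ki.
    by rewrite ki dist_roll_row_pivot.
  have [li|li] := eqVneq l i; last by rewrite dist_roll_row_fixed.
  have -> : k = j by apply: leafj; rewrite -li e_sym.
  by rewrite li dist_sym dist_roll_row_pivot.
have [_ [U [Uo Uc Unon Uhull]]] := hc.
(* The contacts persist for all s and [Unon] keeps the other pairs apart; together they give a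
   packing, and only then does [Uhull] apply. *)
have gamX : \forall s \near (0 : R), fixed_class e c0 (gam s).
  have : nbhs c U by exact: open_nbhs_nbhs.
  move=> /near_gam; apply: filterS => s Us.
  have non k l : k != l -> ~~ e k l -> 2 < dist (gam s) k l.
    by apply: Unon; split=> //; exact: gamM.
  have pgam : packings (gam s).
    move=> k l kl; have [ekl|nekl] := boolP (e k l); first by rewrite gamM.
    exact/ltW/non.
  split; first exact: Uhull.
  split=> // k l kl; case: ifPn => ekl; first exact: gamM.
  exact: non.
have phimin : \forall s \near (0 : R),
    (Per_tilde c0 \o gam) 0 <= (Per_tilde c0 \o gam) s.
  near=> s.
  have [[pg [_ hullEs]] cgs] : fixed_class e c0 (gam s) by near: s.
  have : (Per c <= Per (gam s))%E.
    by near: s; apply: filterS2 gamX (near_gam _ cmin) => s X; apply.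
  rewrite !PerE//; last exact: packings_row_inj pg.
  (* Both perimeters are now sums over the edges of [c0]; the common circle term cancels because it
     is finite. *)
  rewrite hullE hullEs leeD2rE ?hausdorff1_circle_fin// lee_fin /= gam0.
  by rewrite /Per_tilde lerD2r.
have phidiff : differentiable (Per_tilde c0 \o gam) 0.
  by apply: differentiable_comp; rewrite ?gam0.
have := derive1_local_min (proj2 (derivable1_diffP _ _) phidiff) phimin.
rewrite deriveE// diff_comp ?gam0//= gdE scale1r dPer -/a => h.
(* The factor 2 is the contact distance, and [a] points from centre j to centre i, against [u]. *)
have aE : a = - 2 *: u.
  rewrite /a -opprB (enorm_normalizeE (row j c - row i c)) -/(udir c i j).
  by rewrite -/(dist c i j) dij scaleNr.
have perpa : perp a = - 2 *: perp u by rewrite aE; apply: rV2P; rewrite !mxE/=; ring.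
move: h; rewrite perpa dotZr => /eqP; rewrite mulf_eq0 oppr_eq0 pnatr_eq0/=.
by move/eqP.
Unshelve. all: by end_near.
Qed.
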